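(* Let $(E,\mathcal E)$ be a Borel space and let $(\eta_t)_{t\ge 0}$ be a Markov process on $\mathbf N_{<\infty}$ with Markov semigroup $(P_t)_{t\ge 0}$ which is consistent and conservative. Let $\rho$ be a reversible probability measure for $(\eta_t)_{t\ge0}$ on $(\mathbf N_{<\infty},\mathcal N_{<\infty})$ such that $\int\eta(E)^n\,\rho(\mathrm d\eta)<\infty$ for all $n\in\mathbb N$. Then $$P_tI_n(f_n,\cdot)(\eta)=I_n\bigl(p_t^{[n]}f_n,\eta\bigr)$$ for $\rho$-almost all $\eta\in\mathbf N_{<\infty}$, all $t\ge0$, all $n\in\mathbb N$ and all $f_n\in\mathcal F_n$.
   Context: $(E,\mathcal E)$ is a Borel space. $\mathbf N_{<\infty}$ is the set of finite measures on $(E,\mathcal E)$ taking values in $\mathbb N_0$, with the $\sigma$-algebra $\mathcal N_{<\infty}$ generated by the maps $\eta\mapsto\eta(B)$, $B\in\mathcal E$. Every $\eta\in\mathbf N_{<\infty}$ is $0$ or of the form $\delta_{x_1}+\dots+\delta_{x_m}$. A Markov process on $\mathbf N_{<\infty}$ is a collection $(\Omega,\mathfrak F,(\eta_t)_{t\ge0},(\mathbb P_\eta)_{\eta\in\mathbf N_{<\infty}})$ with $\eta_t:\Omega\to\mathbf N_{<\infty}$ measurable, $\mathbb P_\eta(\eta_0=\eta)=1$, and the Markov property with respect to the natural filtration; $P_tf(\eta)=\mathbb E_\eta[f(\eta_t)]$. For a reversible $\rho$, $P_t$ is regarded as a bounded self-adjoint operator on $L^2(\rho)=L^2(\mathbf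 N_{<\infty},\mathcal N_{<\infty},\rho)$; reversible means $\int f\,P_tg\,\mathrm d\rho=\int g\,P_tf\,\mathrm d\rho$ for bounded measurable $f,g$ and $t\ge 0$. Lowering operator: $\mathcal A f(\eta):=\int f(\eta-\delta_x)\,\eta(\mathrm dx)$, for measurable $f:\mathbf N_{<\infty}\to\mathbb R$ bounded on each $\{\eta:\eta(E)=n\}$. Consistent: $P_t\mathcal A f(\eta)=\mathcal A P_tf(\eta)$ for all $t\ge0$, all bounded measurable $f$ and all $\eta\in\mathbf N_{<\infty}$. Conservative: $\eta_t(E)=\eta_0(E)$ for all $t\ge0$ whenever $\eta_0\in\mathbf N_{<\infty}$. $\mathcal F_n$ is the set of bounded, measurable, permutation invariant functions $E^n\to\mathbb R$. The $n$-particle semigroup $p_t^{[n]}$ acts on $\mathcal F_n$ by $(p_t^{[n]}f_n)(x_1,\dots,x_n):=(P_tf)(\delta_{x_1}+\dots+\delta_{x_n})$, where $f:\mathbf N_{<\infty}\to\mathbb R$ is bounded measurable with $f(\delta_{x_1}+\dots+\delta_{x_n})=f_n(x_1,\dots,x_n)$ (well defined because the process is conservative). Write $\eta^{\otimes k}(f_k):=\int f_k\,\mathrm d\eta^{\otimes k}$ for bounded measurable $f_k:E^k\to\mathbb R$, with $\eta^{\otimes0}(f_0):=f_0\in\mathbb R$. $\mathcal P_n\subset L^2(\rho)$ is the set of linear combinations of maps $\eta\mapsto\eta^{\otimes k}(f_k)$, $0\le k\le n$, with $f_k$ bounded measurable; $\overline{\mathcal P_n}$ is its closure in $L^2(\rho)$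 and $\overline{\mathcal P_n}^{\perp}$ the orthogonal complement. For $n\in\mathbb N$ and bounded measurable $f_n:E^n\to\mathbb R$, the generalized orthogonal polynomial $I_n(f_n,\cdot)$ is the orthogonal projection in $L^2(\rho)$ of $\eta\mapsto\eta^{\otimes n}(f_n)$ onto $\overline{\mathcal P_{n-1}}^{\perp}$ (defined up to $\rho$-null sets). *)

(* Defs.v *)
From HB Require Import structures.
From mathcomp Require Import all_boot all_order all_algebra perm.
From mathcomp Require Import all_classical all_reals all_analysis.
From mathcomp Require Import measurable_realfun.

Set Implicit Arguments.
Unset Strict Implicit.
Unset Printing Implicit Defensive.

Import Order.TTheory GRing.Theory Num.Theory.
Import numFieldNormedType.Exports.

Local Open Scope classical_set_scope.
Local Open Scope ring_scope.

(* Borel space: measurably isomorphic to a Borel subset of [0, 1]. Taking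
   A := setT in the last clause, the range of phi is Borel; for general A the
   clause says that the inverse of phi is measurable. *)
Definition borel_space (R : realType) d (E : measurableType d) : Prop :=
  exists phi : E -> R,
    [/\ measurable_fun setT phi, injective phi,
        forall x, 0 <= phi x <= 1 &
        forall A : set E, measurable A -> measurable (phi @` A)].

Definition bounded_measurable (R : realType) d (T : measurableType d)
    (f : T -> R) : Prop :=
  measurable_fun setT f /\ exists M : R, forall x, `|f x| <= M.

Section finite_integer_measures.
Context (R : realType) d (E : measurableType d).
Local Open Scope ereal_scope.

(* A library measure is a function on all subsets of E whose values on
   non-measurable subsets are arbitrary. Pinning those values to 0 makes
   Leibniz equality on Nfin coincide with equality of measures on the
   sigma-algebra of E (lemma nfin_ext below). *)
Record Nfin := MkNfin {
  nfin_measure :> {finite_measure set E -> \bar R} ;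
  nfin_nat : forall A, measurable A -> exists n : nat, nfin_measure A = n%:R%:E ;
  nfin_out : forall A, ~ measurable A -> nfin_measure A = 0 }.

Lemma nfin_ext (eta xi : Nfin) :
  (forall A, measurable A -> eta A = xi A) -> eta = xi.
Proof.
move=> h; have /funext {h} : forall A, eta A = xi A.
  move=> A; have [mA|nA] := pselect (measurable A); first exact: h.
  by rewrite !nfin_out.
case: eta xi => m1 n1 o1 [m2 n2 o2] /= m12.
suff e : m1 = m2.
  by move: n2 o2 {m12}; rewrite -e => n2 o2; rewrite (Prop_irrelevance n1 n2) (Prop_irrelevance o1 o2).
case: m1 m12 {n1 o1} => f1 c1; case: m2 {n2 o2} => f2 c2 /= f12; subst f2.
congr FiniteMeasure.Pack.
case: c1 => [[p1 q1] [r1] [s1] [t1] [u1]].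
case: c2 => [[p2 q2] [r2] [s2] [t2] [u2]].
rewrite (Prop_irrelevance p2 p1) in r2 *; rewrite (Prop_irrelevance q2 q1) in r2 *.
by rewrite (Prop_irrelevance r2 r1) (Prop_irrelevance s2 s1)
  (Prop_irrelevance t2 t1) (Prop_irrelevance u2 u1).
Qed.

Section trim.
Variable m : {measure set E -> \bar R}.
Hypothesis mnat : forall A, measurable A -> exists n : nat, m A = n%:R%:E.

Definition trim (A : set E) : \bar R := if `[< measurable A >] then m A else 0.

Let trim_meas A : measurable A -> trim A = m A.
Proof. by rewrite /trim => /asboolP ->. Qed.

Let trim0 : trim set0 = 0.
Proof. by rewrite trim_meas// measure0. Qed.

Let trim_ge0 A : 0 <= trim A.
Proof. by rewrite /trim; case: ifP. Qed.

Let trim_sigma_additive : semi_sigma_additive trim.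
Proof.
move=> F mF tF mUF; rewrite trim_meas//.
rewrite (_ : (fun n => _) = fun n => \sum_(0 <= i < n) m (F i)).
  exact: measure_semi_sigma_additive.
by apply/funext => n; apply: eq_bigr => i _; rewrite trim_meas.
Qed.

HB.instance Definition _ :=
  isMeasure.Build d E R trim trim0 trim_ge0 trim_sigma_additive.

Let trim_fin : fin_num_fun trim.
Proof. by move=> A mA; rewrite trim_meas//; have [n ->] := mnat mA. Qed.

HB.instance Definition _ := Measure_isFinite.Build d E R trim trim_fin.

Let trim_nat A : measurable A -> exists n : nat, trim A = n%:R%:E.
Proof. by move=> mA; rewrite trim_meas//; exact: mnat. Qed.

Let trim_out A : ~ measurable A -> trim A = 0.
Proof. by rewrite /trim => /asboolPn/negbTE ->. Qed.

Definition nfin_of : Nfin := MkNfin trim_nat trim_out.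

Lemma nfin_ofE A : measurable A -> nfin_of A = m A.
Proof. exact: trim_meas. Qed.

End trim.

Lemma mzero_nat (A : set E) : measurable A ->
  exists n : nat, (mzero A : \bar R) = n%:R%:E.
Proof. by move=> _; exists 0%N. Qed.

Definition nfin0 : Nfin := nfin_of mzero_nat.

Lemma diracs_nat n (x : n.-tuple E) (A : set E) : measurable A ->
  exists k : nat, msum (fun i => \d_(nth point x i)) n A = k%:R%:E :> \bar R.
Proof.
move=> _; rewrite /msum; elim: n {x} (tval x) => [|n IH] x.
  by exists 0%N; rewrite big_ord0.
rewrite big_ord_recr/=; have [k ->] := IH x.
by exists (k + (nth point x n \in A))%N; rewrite diracE natrD EFinD.
Qed.

(* delta_{x_1} + ... + delta_{x_n} *)
Definition diracs n (x : n.-tuple E) : Nfin := nfin_of (diracs_nat x).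

Lemma diracsE n (x : n.-tuple E) A : measurable A ->
  diracs x A = \sum_(i < n) \d_(tnth x i) A.
Proof.
move=> mA; rewrite nfin_ofE// /msum.
by apply: eq_bigr => i _; rewrite (tnth_nth point).
Qed.

HB.instance Definition _ := gen_eqMixin Nfin.
HB.instance Definition _ := gen_choiceMixin Nfin.
HB.instance Definition _ := isPointed.Build Nfin nfin0.

(* eta - delta_x, i.e. the xi with xi + delta_x = eta. There is none when x is
   not an atom of eta; the value nfin0 then taken is irrelevant below, since
   eta-almost every x is an atom. *)
Definition remove (eta : Nfin) (x : E) : Nfin :=
  xget nfin0 [set xi | forall A, measurable A -> xi A + \d_x A = eta A].

Definition nfin_measurable : set (set Nfin) :=
  <<s \bigcup_(B in measurable)
        preimage_set_system setT (fun eta : Nfin => eta B : \bar R)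
          measurable >>.

Let nfin_measurable0 : nfin_measurable set0.
Proof. exact: sigma_algebra0. Qed.

Let nfin_measurableC (U : set Nfin) :
  nfin_measurable U -> nfin_measurable (~` U).
Proof. exact: sigma_algebraC. Qed.

Let nfin_measurableU (F : (set Nfin)^nat) :
  (forall i, nfin_measurable (F i)) -> nfin_measurable (\bigcup_i F i).
Proof. exact: sigma_algebra_bigcup. Qed.

Definition nfin_display : measure_display.
Proof. by constructor. Qed.

HB.instance Definition _ := @isMeasurable.Build nfin_display Nfin
  nfin_measurable nfin_measurable0 nfin_measurableC nfin_measurableU.

End finite_integer_measures.

Section product_power.
Context (R : realType) d (E : measurableType d).
Local Open Scope ereal_scope.

Section cons.
Context k (m1 : {finite_measure set E -> \bar R})
  (m2 : {finite_measure set (k.-tuple E) -> \bar R}).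

Definition tuple_cons (p : E * k.-tuple E) : k.+1.-tuple E :=
  [tuple of p.1 :: p.2].

Lemma measurable_tuple_cons : measurable_fun setT tuple_cons.
Proof. exact: measurable_cons. Qed.

Definition mcons : set (k.+1.-tuple E) -> \bar R :=
  pushforward (m1 \x m2) tuple_cons.

Let mcons0 : mcons set0 = 0.
Proof. by rewrite /mcons /pushforward preimage_set0 measure0. Qed.

Let mcons_ge0 A : 0 <= mcons A.
Proof. by rewrite /mcons /pushforward; exact: measure_ge0. Qed.

Let measurable_preimage (A : set (k.+1.-tuple E)) : measurable A ->
  measurable (tuple_cons @^-1` A).
Proof.
by move=> mA; rewrite -[X in measurable X]setTI; exact: measurable_tuple_cons.
Qed.

Let mcons_sigma_additive : semi_sigma_additive mcons.
Proof.
move=> F mF tF mUF; rewrite /mcons /pushforward preimage_bigcup.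
apply: measure_semi_sigma_additive.
- by move=> i; exact: measurable_preimage.
- apply/trivIsetP => i j _ _ ij; rewrite -preimage_setI.
  by move/trivIsetP : tF => -> //; rewrite preimage_set0.
- by rewrite -preimage_bigcup; exact: measurable_preimage.
Qed.

HB.instance Definition _ :=
  isMeasure.Build _ _ R mcons mcons0 mcons_ge0 mcons_sigma_additive.

Let mcons_fin : fin_num_fun mcons.
Proof.
apply: (@lty_fin_num_fun _ _ R mcons).
rewrite /= /mcons /pushforward preimage_setT -setXTT.
rewrite product_measure1E// -ge0_fin_numE ?mule_ge0//.
by rewrite fin_numM//; exact: fin_num_measure.
Qed.

HB.instance Definition _ := Measure_isFinite.Build _ _ R mcons mcons_fin.

End cons.

(* eta^{(x) k}; for k = 0 the unit mass on the one-point space E^0 *)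
Fixpoint mpow (eta : {finite_measure set E -> \bar R}) k :
    {finite_measure set (k.-tuple E) -> \bar R} :=
  match k with
  | 0%N => \d_[tuple]
  | k'.+1 => mcons eta (mpow eta k')
  end.

End product_power.

Section monomials.
Context (R : realType) d (E : measurableType d).

Definition tensor (eta : Nfin R E) k (f : k.-tuple E -> R) : R :=
  \int[mpow eta k]_x f x.

Definition polys (n : nat) : set (Nfin R E -> R) :=
  [set F | exists (m : nat) (c : 'I_m -> R) (k : 'I_m -> nat)
             (f : forall i, (k i).-tuple E -> R),
     (forall i, (k i <= n)%N /\ bounded_measurable (f i)) /\
     F = (fun eta => \sum_(i < m) c i * tensor eta (f i))].

Definition symmetric_bounded n (f : n.-tuple E -> R) : Prop :=
  bounded_measurable f /\
  forall (s : 'S_n) (x : n.-tuple E), f [tuple tnth x (s i) | i < n] = f x.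

Definition lowering (f : Nfin R E -> R) (eta : Nfin R E) : R :=
  \int[eta]_x f (remove eta x).

End monomials.

(* Elements of L^2(mu) are handled through their measurable representatives;
   all the sets of functions below are stable under mu-a.e. equality. *)
Section L2.
Context (R : realType) d (T : measurableType d) (mu : {measure set T -> \bar R}).

Definition L2 : set (T -> R) := [set f | f \in Lfun mu 2%:E].

Definition L2_inner (f g : T -> R) : R := \int[mu]_x (f x * g x).

Definition L2_closure (S : set (T -> R)) : set (T -> R) :=
  [set f | L2 f /\ forall e : R, 0 < e ->
     exists2 g, S g & ('N[mu]_2%:E[EFin \o (f \- g)%R] < e%:E)%E].

Definition L2_orth (S : set (T -> R)) : set (T -> R) :=
  [set f | L2 f /\ forall g, S g -> L2_inner f g = 0].

Definition is_L2_proj (K : set (T -> R)) (f h : T -> R) : Prop :=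
  K h /\ L2_orth K (f \- h).

(* A representative of the orthogonal projection of f onto K, which is unique
   up to mu-a.e. equality. *)
Definition L2_proj (K : set (T -> R)) (f : T -> R) : T -> R :=
  get (is_L2_proj K f).

End L2.

Section orthogonal_polynomials.
Context (R : realType) d (E : measurableType d).

(* For n >= 1, a representative of the generalized orthogonal polynomial. *)
Definition orth_poly (rho : probability (Nfin R E) R) n (f : n.-tuple E -> R) :
    Nfin R E -> R :=
  L2_proj rho (L2_orth rho (L2_closure rho (@polys R d E n.-1)))
    (fun eta => tensor eta f).

End orthogonal_polynomials.

Section conditional_expectation.
Context (R : realType) d (T : measurableType d).

(* Z = E[Y | G] almost surely, for a sub-sigma-algebra G *)
Definition is_cond_exp (P : probability T R) (G : set (set T)) (Y Z : T -> R) :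
    Prop :=
  [/\ forall B : set R, measurable B -> G (Z @^-1` B),
      P.-integrable setT (EFin \o Z) &
      forall A, G A -> \int[P]_(w in A) Z w = \int[P]_(w in A) Y w].

End conditional_expectation.

Section markov_process.
Context (R : realType) d (E : measurableType d) d' (Om : measurableType d').
Variables (X : R -> Om -> Nfin R E) (P : Nfin R E -> probability Om R).

Definition natural_filtration (s : R) : set (set Om) :=
  <<s \bigcup_(u in [set u | 0 <= u <= s])
        preimage_set_system setT (X u) measurable >>.

(* If rho is reversible, hence invariant, and f is in L^2(rho), the integral
   converges absolutely for rho-a.e. eta, and the function obtained depends up
   to rho-null sets only on the class of f: this is the operator P_t on
   L^2(rho). *)
Definition semigroup (t : R) (f : Nfin R E -> R) (eta : Nfin R E) : R :=
  \int[P eta]_w f (X t w).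

Record is_markov_process : Prop := {
  markov_measurable : forall t, 0 <= t -> measurable_fun setT (X t) ;
  markov_init : forall eta, {ae P eta, forall w, X 0 w = eta} ;
  markov_kernel : forall t, 0 <= t -> forall B, measurable B ->
    measurable_fun setT (fun eta => P eta (X t @^-1` B)) ;
  markov_property : forall s t, 0 <= s -> 0 <= t -> forall f,
    bounded_measurable f -> forall eta,
    is_cond_exp (P eta) (natural_filtration s)
      (fun w => f (X (s + t) w)) (fun w => semigroup t f (X s w)) }.

Definition consistent : Prop :=
  forall t, 0 <= t -> forall f, bounded_measurable f -> forall eta,
    semigroup t (lowering f) eta = lowering (semigroup t f) eta.

Definition conservative : Prop :=
  forall eta, {ae P eta, forall w, forall t, 0 <= t ->
    X t w setT = X 0 w setT}.

Definition reversible (rho : probability (Nfin R E) R) : Prop :=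
  forall t, 0 <= t -> forall f g,
    bounded_measurable f -> bounded_measurable g ->
    \int[rho]_eta (f eta * semigroup t g eta) =
    \int[rho]_eta (g eta * semigroup t f eta).

(* A bounded measurable f on Nfin with f (delta_{x_1} + ... + delta_{x_n}) =
   fn (x_1, ..., x_n); for a conservative process npart_semigroup does not
   depend on which one is chosen. *)
Definition extension n (fn : n.-tuple E -> R) : Nfin R E -> R :=
  get [set f : Nfin R E -> R |
    bounded_measurable f /\ forall x, f (diracs R x) = fn x].

Definition npart_semigroup (t : R) n (fn : n.-tuple E -> R) (x : n.-tuple E) :
    R :=
  semigroup t (extension fn) (diracs R x).

End markov_process.

(* Main.v *)
(* Write A for the lowering operator, and regard a function F on configurations
   as a function of the list of atoms. The operator exp(-A) computes iterated
   differences: exp(-A) F at x_1, ..., x_m is the m-th difference of F at 0 in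
   the directions x_1, ..., x_m. Hence the polynomials of degree at most n are
   exactly the functions F, bounded on each level eta(E) = m, for which exp(-A) F
   vanishes on configurations of more than n points, and the leading term of
   eta^{(x) n}(f), for symmetric f, is read off from
   exp(-A) (eta^{(x) n}(f)) (x_1, ..., x_n) = n! f(x_1, ..., x_n).
   By consistency P_t commutes with A, hence with exp(-A), and by conservativity
   it preserves the levels. So P_t preserves the polynomials of degree at most
   n - 1, and P_t(eta^{(x) n}(f)) and eta^{(x) n}(p_t f) have the same leading
   term, i.e. differ by such a polynomial. As P_t is symmetric on L^2(rho) it also
   preserves the orthogonal complement of these polynomials, so that P_t I_n(f)
   satisfies the characterization of the projection I_n(p_t f). *)

Require Import Defs.
From HB Require Import structures.
From mathcomp Require Import all_boot all_order all_algebra perm.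
From mathcomp Require Import all_classical all_reals all_analysis.
From mathcomp Require Import measurable_realfun.
From mathcomp Require Import zify ring lra.
Import Order.TTheory GRing.Theory Num.Theory.
Import numFieldNormedType.Exports.
Local Open Scope classical_set_scope.
Local Open Scope ring_scope.

Set Implicit Arguments.
Unset Strict Implicit.
Unset Printing Implicit Defensive.

(** * Functions on finite sequences *)

(** Consistency and reversibility are assumed for bounded functions only, whereas polynomials are
    unbounded. For consistency, neither A nor P_t looks at configurations with more points than the
    given one, so F may be replaced by 0 on all higher levels. For reversibility, testing with
    constants and indicators shows that rho is invariant; hence P_t maps L^2(rho) to itself, and
    truncations are removed by dominated convergence. The Borel property supplies a measurable
    enumeration of the atoms. It turns each configuration into a list, on which the algebra is done
    by recursion, and reduces measurability on configurations to measurability on the powers of E.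
    The projections are picked by choice, so nothing is known about them until a projection is shown
    to exist. It is built from a minimizing sequence whose excess decays like 4^-n, fast enough for
    almost everywhere convergence. *)

Section lists.
Context (R : numFieldType) (E : eqType).
Implicit Types (F g f : seq E -> R) (s : seq E).

(* exp(c A) for A the operator lower_seq below (lemma exp_lower_seqE); the
   recursion comes from the commutation rule
   A F (x :: s) = F s + A (fun l => F (x :: l)) s. For c = -1 this is the
   iterated difference of F at [::] along s. *)
Fixpoint exp_lower_seq (c : R) F s : R :=
  if s is x :: s' then
    exp_lower_seq c (fun l => F (x :: l)) s' + c * exp_lower_seq c F s'
  else F [::].

Definition del_at i s := take i s ++ drop i.+1 s.

Definition lower_seq F s : R := \sum_(i < size s) F (del_at i s).

(* The integral of F against the k-th tensor power of the sum of the Dirac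
   masses at s. *)
Fixpoint powsum k F s : R :=
  if k is k'.+1 then \sum_(y <- s) powsum k' (fun l => F (y :: l)) s else F [::].

(** Degree is measured by finite differences: any n successive differences, at every base point and
    not just at [[::]], annihilate F. *)
Fixpoint deg_lt n F : Prop :=
  if n is n'.+1 then forall x, deg_lt n' (fun s => F (x :: s) - F s)
  else forall s, F s = 0.

Lemma eq_exp_lower_seq c F g : F =1 g -> exp_lower_seq c F =1 exp_lower_seq c g.
Proof.
move=> Fg s; elim: s F g Fg => [|x s IH] F g Fg /=; first exact: Fg.
by congr (_ + _ * _); apply: IH => // l; rewrite Fg.
Qed.

Lemma exp_lower_seqD c F g s :
  exp_lower_seq c (fun l => F l + g l) s = exp_lower_seq c F s + exp_lower_seq c g s.
Proof.
elim: s F g => [|x s IH] F g //=.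
by rewrite (IH (fun l => F (x :: l))) IH mulrDr addrACA.
Qed.

Lemma exp_lower_seqZ c a F s :
  exp_lower_seq c (fun l => a * F l) s = a * exp_lower_seq c F s.
Proof.
elim: s F => [|x s IH] F //=.
by rewrite (IH (fun l => F (x :: l))) IH mulrDr mulrCA.
Qed.

Lemma exp_lower_seq0 c s : exp_lower_seq c (fun=> 0) s = 0.
Proof. by elim: s => //= x s ->; rewrite mulr0 addr0. Qed.

Lemma exp_lower_seqB c F g s :
  exp_lower_seq c (fun l => F l - g l) s = exp_lower_seq c F s - exp_lower_seq c g s.
Proof.
rewrite -mulN1r -exp_lower_seqZ -exp_lower_seqD.
by apply: eq_exp_lower_seq => l; rewrite mulN1r.
Qed.

(** The identity exp(A) exp(-A) = 1: a function is determined by its iterated differences at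
    [[::]]. *)
Lemma exp_lower_seqK F s : exp_lower_seq 1 (exp_lower_seq (-1) F) s = F s.
Proof.
elim: s F => [|x s IH] F //=.
by rewrite exp_lower_seqD exp_lower_seqZ !IH mul1r mulN1r subrK.
Qed.

(** For c = -1 the recursion takes one difference in direction x, which is also the recursion of
    [deg_lt]. *)
Lemma exp_lower_seqN_cons F x s :
  exp_lower_seq (-1) F (x :: s) = exp_lower_seq (-1) (fun l => F (x :: l) - F l) s.
Proof. by rewrite exp_lower_seqB /= mulN1r. Qed.

Lemma exp_lower_seqN_deg_lt n F s : deg_lt n F -> (n <= size s)%N ->
  exp_lower_seq (-1) F s = 0.
Proof.
elim: n F s => [|n IH] F s dF.
  by move=> _; rewrite -(exp_lower_seq0 (-1) s); exact: eq_exp_lower_seq.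
by case: s => // x s sz; rewrite exp_lower_seqN_cons; apply: IH.
Qed.

Lemma eq_deg_lt n F g : F =1 g -> deg_lt n F -> deg_lt n g.
Proof.
elim: n F g => [|n IH] F g Fg /=; first by move=> F0 s; rewrite -Fg.
by move=> dF x; apply: IH (dF x) => s; rewrite !Fg.
Qed.

Lemma deg_ltD n F g : deg_lt n F -> deg_lt n g -> deg_lt n (fun s => F s + g s).
Proof.
elim: n F g => [|n IH] F g dF dg; first by move=> s; rewrite dF dg addr0.
move=> x; apply: eq_deg_lt (IH _ _ (dF x) (dg x)) => s.
by rewrite opprD addrACA.
Qed.

Lemma deg_ltS n F : deg_lt n F -> deg_lt n.+1 F.
Proof.
elim: n F => [|n IH] F dF; first by move=> x s /=; rewrite !dF subr0.
by move=> x; apply: IH; apply: dF.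
Qed.

Lemma deg_lt_cons n F x : deg_lt n F -> deg_lt n (fun s => F (x :: s)).
Proof.
case: n F => [|n] F dF; first by move=> s; exact: dF.
apply: (@eq_deg_lt _ (fun s => (F (x :: s) - F s) + F s)).
  by move=> s; rewrite subrK.
by apply: deg_ltD => //; apply: deg_ltS; exact: dF.
Qed.

(** The difference of the sum in direction x consists of the new term [H x (x :: s)], of the degree
    of H, and of the sum of the differences of the [H y], to which induction applies. *)
Lemma deg_lt_sum n (H : E -> seq E -> R) : (forall y, deg_lt n (H y)) ->
  deg_lt n.+1 (fun s => \sum_(y <- s) H y s).
Proof.
elim: n H => [|n IH] H dH.
  by move=> x s /=; rewrite !big1_seq ?subrr// => y _; exact: dH.
move=> x.
apply: (@eq_deg_lt _ (fun s => H x (x :: s) + \sum_(y <- s) (H y (x :: s) - H y s))).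
  by move=> s; rewrite big_cons -addrA -sumrB.
apply: deg_ltD; first exact: deg_lt_cons.
by apply: (IH (fun y s => H y (x :: s) - H y s)) => y; exact: dH.
Qed.

Lemma deg_lt_powsum k F : deg_lt k.+1 (powsum k F).
Proof.
elim: k F => [|k IH] F; first by move=> x s /=; rewrite subrr.
exact: deg_lt_sum.
Qed.

Lemma size_del_at i s : (i < size s)%N -> size (del_at i s) = (size s).-1.
Proof.
move=> si; rewrite size_cat size_drop size_take si; lia.
Qed.

(** Of the [size s] differences, one is spent on the summation variable. The degree bound discards
    the terms in which all of them would fall on H. *)
Lemma exp_lower_seqN_sum (H : E -> seq E -> R) y0 s :
  (forall y, deg_lt (size s) (H y)) ->
  exp_lower_seq (-1) (fun s => \sum_(y <- s) H y s) s =
  \sum_(i < size s) exp_lower_seq (-1) (H (nth y0 s i)) (del_at i s).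
Proof.
elim: s H => [|x s IH] H dH; first by rewrite /= big_nil big_ord0.
rewrite exp_lower_seqN_cons.
under eq_exp_lower_seq do rewrite big_cons -addrA -sumrB.
rewrite exp_lower_seqD (IH (fun y s => H y (x :: s) - H y s)); last by move=> y; exact: dH.
rewrite [RHS]big_ord_recl /= /del_at /= drop0; congr (_ + _).
  have := @exp_lower_seqN_deg_lt _ _ (x :: s) (dH x) (leqnn _).
  by rewrite exp_lower_seqN_cons exp_lower_seqB => /eqP; rewrite subr_eq0 => /eqP.
apply: eq_bigr => i _; rewrite /bump /= add1n /=.
by rewrite -exp_lower_seqN_cons.
Qed.

Definition sym_seq F := forall s s', perm_eq s s' -> F s = F s'.

Lemma sym_seq_cons F x : sym_seq F -> sym_seq (fun l => F (x :: l)).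
Proof. by move=> sF s s' ss'; apply: sF; rewrite perm_cons. Qed.

Lemma perm_del_at y0 i s : (i < size s)%N ->
  perm_eq (nth y0 s i :: del_at i s) s.
Proof.
move=> si; rewrite -[X in perm_eq _ X](cat_take_drop i).
by rewrite (drop_nth y0 si) perm_sym perm_catC /= perm_cons perm_catC.
Qed.

(** Each of the k points can be the first coordinate, and leaves the same problem with k - 1 points;
    by symmetry all choices contribute equally, whence the factorial. *)
Lemma exp_lower_seqN_powsum k F s : sym_seq F -> size s = k ->
  exp_lower_seq (-1) (powsum k F) s = k`!%:R * F s.
Proof.
elim: k F s => [|k IH] F s sF sk; first by rewrite (size0nil sk) mul1r.
case: s sk => // y0 s' sk; set s := y0 :: s' in sk *.
rewrite (@exp_lower_seqN_sum (fun y l => powsum k (fun l' => F (y :: l')) l) y0); last first.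
  by move=> y; rewrite sk; exact: deg_lt_powsum.
transitivity (\sum_(i < size s) k`!%:R * F s).
  apply: eq_bigr => i _; rewrite IH; last 2 first.
  - exact: sym_seq_cons.
  - by rewrite size_del_at// sk.
  by congr (_ * _); apply: sF; apply: perm_del_at.
by rewrite sumr_const card_ord sk -[LHS]mulr_natl mulrA -natrM factS.
Qed.

Lemma powsum_bound k F s M : 0 <= M ->
  (forall l, size l = k -> `|F l| <= M) -> `|powsum k F s| <= M * (size s)%:R ^+ k.
Proof.
move=> M0; elim: k F => [|k IH] F FM /=; first by rewrite expr0 mulr1 FM.
apply: (le_trans (ler_norm_sum _ _ _)).
apply: (@le_trans _ _ (\sum_(y <- s) M * (size s)%:R ^+ k)).
  by apply: ler_sum => y _; apply: IH => l lk; apply: FM; rewrite /= lk.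
by rewrite big_const_seq count_predT iter_addr addr0 exprS -[leLHS]mulr_natl mulrCA.
Qed.

Lemma lower_seq_cons F x s :
  lower_seq F (x :: s) = F s + lower_seq (fun l => F (x :: l)) s.
Proof. by rewrite /lower_seq /= big_ord_recl /= /del_at /= drop0. Qed.

(** With T F = F (x :: _), [lower_seq_cons] is the commutation relation T A = A T + 1. Iterating
    gives T A^m = A^m T + m A^(m-1); for m = 0 the predecessor is harmless because its coefficient
    is 0. *)
Lemma iter_lower_cons m F x s :
  iter m lower_seq F (x :: s) =
  iter m lower_seq (fun l => F (x :: l)) s + m%:R * iter m.-1 lower_seq F s.
Proof.
elim: m s => [|m IH] s; first by rewrite mul0r addr0.
rewrite iterS lower_seq_cons.
have -> : lower_seq (fun l => iter m lower_seq F (x :: l)) s =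
  iter m.+1 lower_seq (fun l => F (x :: l)) s + m%:R * iter m lower_seq F s.
  under [LHS]eq_bigr do rewrite IH.
  rewrite big_split /= -mulr_sumr; congr (_ + _).
  by case: m {IH} => [|m]; rewrite ?mul0r.
by rewrite -natr1 mulrDl mul1r [RHS]addrA addrC.
Qed.

Lemma iter_lower_gt m F s : (size s < m)%N -> iter m lower_seq F s = 0.
Proof.
elim: m s => // m IH s; rewrite ltnS => sm.
rewrite iterS /lower_seq big1// => i _; apply: IH.
by rewrite size_del_at//; case: (s) i sm => [[]|].
Qed.

(** The exponential series is finite because A removes a point each time. Leaving M free lets the
    induction use two different truncations. *)
Lemma exp_lower_seqE c F s M : (size s < M)%N ->
  exp_lower_seq c F s = \sum_(m < M) c ^+ m / m`!%:R * iter m lower_seq F s.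
Proof.
elim: s F M => [|x s IH] F M sM.
  case: M sM => // M _; rewrite big_ord_recl big1/=.
    by rewrite expr0 fact0 divr1 mul1r addr0.
  by move=> i _; rewrite -iterS iter_lower_gt// mulr0.
case: M sM => // M sM.
under eq_bigr do rewrite iter_lower_cons mulrDr.
rewrite big_split /= -IH; last by apply: (@leq_trans M) => //.
congr (_ + _).
(* The term of index 0 has coefficient 0; in the others m / m! = 1 / (m - 1)!, which shifts the
   series by one and releases a factor c. *)
rewrite big_ord_recl mul0r mulr0 add0r (IH F M)// mulr_sumr.
apply: eq_bigr => i _; rewrite lift0 /= !mulrA; congr (_ * _).
rewrite exprS factS natrM invfM -!mulrA; congr (_ * (_ * _)).
by rewrite mulrCA mulVf ?mulr1// pnatr_eq0.
Qed.

(** Deletion by value is what [remove] does on measures; for a symmetric F it does not matter which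
    copy of a repeated point is deleted. *)
Lemma lower_seq_rem F s : sym_seq F -> lower_seq F s = \sum_(y <- s) F (rem y s).
Proof.
elim: s F => [|x s IH] F sF; first by rewrite /lower_seq big_ord0 big_nil.
rewrite lower_seq_cons big_cons /= eqxx; congr (_ + _).
rewrite IH; last exact: sym_seq_cons.
apply: eq_big_seq => y ys; case: eqP ys => [<-|//] ys.
by apply: sF; rewrite perm_sym perm_to_rem.
Qed.

(** Vanishing at the base point [[::]] alone suffices since exp(-A) is invertible: this settles n =
    0, and each further difference lowers n by one. *)
Lemma deg_lt_exp_lower_seqN n F :
  (forall s, (n <= size s)%N -> exp_lower_seq (-1) F s = 0) -> deg_lt n F.
Proof.
elim: n F => [|n IH] F H.
  move=> s; rewrite -[F s]exp_lower_seqK -(exp_lower_seq0 1 s).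
  by apply: eq_exp_lower_seq => l; rewrite H.
by move=> x; apply: IH => s sn; rewrite -exp_lower_seqN_cons; exact: H.
Qed.

Lemma deg_ltZ n a F : deg_lt n F -> deg_lt n (fun s => a * F s).
Proof.
elim: n F => [|n IH] F dF; first by move=> s; rewrite dF mulr0.
by move=> x; apply: eq_deg_lt (IH _ (dF x)) => s; rewrite mulrBr.
Qed.

Lemma deg_lt_leq n m F : (n <= m)%N -> deg_lt n F -> deg_lt m F.
Proof.
move=> /subnK <-; elim: (m - n)%N => // k IH dF.
by rewrite addSn; apply: deg_ltS; exact: IH.
Qed.

Lemma deg_lt_bigsum n m (F : 'I_m -> seq E -> R) : (forall i, deg_lt n (F i)) ->
  deg_lt n (fun s => \sum_(i < m) F i s).
Proof.
elim: m F => [|m IH] F dF.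
  apply: (@deg_lt_leq 0) => // s; by rewrite big_ord0.
apply: (eq_deg_lt _ (deg_ltD (dF ord0) (IH (fun i => F (lift ord0 i)) (fun i => dF _)))).
by move=> s; rewrite big_ord_recl.
Qed.

(** The uniformity of B over a level is what makes [exp_lowering] preserve [level_bounded]. *)
Lemma exp_lower_seq_bound c n (M : nat -> R) : exists B, forall F s, size s = n ->
  (forall l, `|F l| <= M (size l)) -> `|exp_lower_seq c F s| <= B.
Proof.
elim: n M => [|n IH] M; first by exists (M 0%N) => F s /size0nil -> /(_ [::]).
have [B1 H1] := IH (fun k => M k.+1); have [B2 H2] := IH M.
exists (B1 + `|c| * B2) => F [//|x s] [sn] FM /=.
apply: (le_trans (ler_normD _ _)); rewrite normrM; apply: lerD.
  by apply: H1 => // l; exact: FM.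
by apply: ler_wpM2l => //; exact: H2.
Qed.

End lists.

(** * Orthogonal projections in L^2 *)

Section inner_product.
Context (R : realType) d (T : measurableType d) (mu : {measure set T -> \bar R}).
Implicit Types f g h : T -> R.

Lemma L2_measurable f : L2 mu f -> measurable_fun setT f.
Proof. by rewrite /L2 /= inE => /andP[]; rewrite inE. Qed.

Lemma L2P f : L2 mu f <->
  measurable_fun setT f /\ mu.-integrable setT (EFin \o (fun x => f x ^+ 2)).
Proof.
split => [Lf|[mf if2]].
  by split; [exact: L2_measurable|exact: Lfun2_integrable_sqr].
rewrite /L2 /= inE; apply/andP; split; rewrite inE//=.
rewrite /finite_norm unlock poweR_lty//.
have [_] := integrableP _ _ _ if2; congr (_ < _)%E.
by apply: eq_integral => x _ /=; rewrite powR_mulrn// -normrX.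
Qed.

Lemma L2_mul f g : L2 mu f -> L2 mu g ->
  mu.-integrable setT (EFin \o (fun x => f x * g x)).
Proof. by move=> Lf Lg; apply/Lfun1_integrable; exact: Lfun2_mul_Lfun1. Qed.

Lemma L2Z a f : L2 mu f -> L2 mu (fun x => a * f x).
Proof.
move=> /L2P[mf if2]; apply/L2P; split; first exact: measurable_funM.
rewrite [X in integrable _ _ X](_ : _ = (fun x => (a ^+ 2)%:E * (f x ^+ 2)%:E)%E).
  exact: integrableZl.
by apply/funext => x /=; rewrite exprMn.
Qed.

Lemma L2D f g : L2 mu f -> L2 mu g -> L2 mu (fun x => f x + g x).
Proof.
move=> Lf Lg; apply/L2P; split.
  by apply: measurable_funD; exact: L2_measurable.
rewrite [X in integrable _ _ X](_ : _ = (fun x => (f x ^+ 2)%:E +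
  (2%:E * (f x * g x)%:E + (g x ^+ 2)%:E))%E).
  apply: integrableD => //; first by have /L2P[] := Lf.
  apply: integrableD => //; last by have /L2P[] := Lg.
  by apply: integrableZl => //; exact: L2_mul.
by apply/funext => x /=; rewrite -EFinM -!EFinD; congr EFin; ring.
Qed.

Lemma L2B f g : L2 mu f -> L2 mu g -> L2 mu (fun x => f x - g x).
Proof.
move=> Lf Lg; rewrite [X in L2 _ X](_ : _ = fun x => f x + (-1) * g x).
  by apply: L2D => //; exact: L2Z.
by apply/funext => x; rewrite mulN1r.
Qed.

Lemma L2_innerC f g : L2_inner mu f g = L2_inner mu g f.
Proof. by apply: eq_Rintegral => x _; rewrite mulrC. Qed.

Lemma L2_innerDl f g h : L2 mu f -> L2 mu g -> L2 mu h ->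
  L2_inner mu (fun x => f x + g x) h = L2_inner mu f h + L2_inner mu g h.
Proof.
move=> Lf Lg Lh; rewrite /L2_inner -RintegralD//; [|exact: L2_mul..].
by apply: eq_Rintegral => x _; rewrite mulrDl.
Qed.

Lemma L2_innerZl a f g : L2 mu f -> L2 mu g ->
  L2_inner mu (fun x => a * f x) g = a * L2_inner mu f g.
Proof.
move=> Lf Lg; rewrite /L2_inner -RintegralZl//; last exact: L2_mul.
by apply: eq_Rintegral => x _; rewrite mulrA.
Qed.

Lemma L2_innerBl f g h : L2 mu f -> L2 mu g -> L2 mu h ->
  L2_inner mu (fun x => f x - g x) h = L2_inner mu f h - L2_inner mu g h.
Proof.
move=> Lf Lg Lh; rewrite -mulN1r -L2_innerZl// -L2_innerDl//; last exact: L2Z.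
by apply: eq_Rintegral => x _; rewrite mulN1r.
Qed.

Lemma L2_innerBr f g h : L2 mu f -> L2 mu g -> L2 mu h ->
  L2_inner mu h (fun x => f x - g x) = L2_inner mu h f - L2_inner mu h g.
Proof. by move=> *; rewrite L2_innerC L2_innerBl// !(L2_innerC h). Qed.

Lemma L2_innerZr a f g : L2 mu f -> L2 mu g ->
  L2_inner mu f (fun x => a * g x) = a * L2_inner mu f g.
Proof. by move=> *; rewrite L2_innerC L2_innerZl// L2_innerC. Qed.

Lemma L2_inner_ge0 f : 0 <= L2_inner mu f f.
Proof. by apply: Rintegral_ge0 => x _; rewrite -expr2 sqr_ge0. Qed.

Lemma L2_innerE f : L2 mu f ->
  (\int[mu]_x (f x ^+ 2)%:E = (L2_inner mu f f)%:E)%E.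
Proof.
move=> Lf; rewrite /L2_inner /Rintegral fineK; last first.
  by apply: integrable_fin_num => //; exact: L2_mul.
by apply: eq_integral => x _; rewrite expr2.
Qed.

(** Stated for numbers because it serves twice: for Cauchy-Schwarz, and for the near-orthogonality
    of a minimizing sequence, where [e] is the excess over the infimum. *)
Lemma sqr_le_discriminant (e b c : R) : 0 <= c ->
  (forall t, 0 <= e - 2 * t * b + t ^+ 2 * c) -> b ^+ 2 <= e * c.
Proof.
rewrite le_eqVlt => /predU1P[<-|c0] h.
  rewrite mulr0; have [->|b0] := eqVneq b 0; first by rewrite expr0n.
  (* For c = 0 the form is affine in t; at this t it equals -1, a contradiction. *)
  have := h ((e + 1) / (2 * b)).
  have -> : e - 2 * ((e + 1) / (2 * b)) * b + ((e + 1) / (2 * b)) ^+ 2 * 0 = -1 by field.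
  lra.
(* The minimizer of the quadratic. *)
have := h (b / c).
have -> : e - 2 * (b / c) * b + (b / c) ^+ 2 * c = (e * c - b ^+ 2) / c.
  by field; rewrite gt_eqF.
by rewrite pmulr_lge0 ?invr_gt0// subr_ge0.
Qed.

Lemma L2_inner_subZ f g t : L2 mu f -> L2 mu g ->
  L2_inner mu (fun x => f x - t * g x) (fun x => f x - t * g x) =
  L2_inner mu f f - 2 * t * L2_inner mu f g + t ^+ 2 * L2_inner mu g g.
Proof.
move=> Lf Lg; have Ltg := L2Z t Lg; have Lftg := L2B Lf Ltg.
rewrite L2_innerBl// !L2_innerBr// !L2_innerZl// !L2_innerZr// (L2_innerC g f).
by ring.
Qed.

Lemma L2_cauchy_schwarz f g : L2 mu f -> L2 mu g ->
  L2_inner mu f g ^+ 2 <= L2_inner mu f f * L2_inner mu g g.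
Proof.
move=> Lf Lg; apply: sqr_le_discriminant; first exact: L2_inner_ge0.
by move=> t; rewrite -L2_inner_subZ//; exact: L2_inner_ge0.
Qed.

Lemma L2_inner_eq0 f : L2 mu f -> L2_inner mu f f = 0 ->
  {ae mu, forall x, f x = 0}.
Proof.
move=> Lf f0; have mf := L2_measurable Lf.
have : (\int[mu]_x `|(f x ^+ 2)%:E| = 0)%E.
  under eq_integral do rewrite gee0_abs ?lee_fin ?sqr_ge0//.
  by rewrite L2_innerE// f0.
move=> /(ae_eq_integral_abs mu measurableT) H.
have /H : measurable_fun setT (fun x => (f x ^+ 2)%:E).
  by apply/measurable_EFinP; exact: measurable_funX.
by apply: filterS => x /= /(_ Logic.I) [] /eqP; rewrite expf_eq0/= => /eqP.
Qed.

Lemma Lnorm2_ltP f (e : R) : L2 mu f -> 0 < e ->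
  ('N[mu]_2%:E[EFin \o f] < e%:E)%E <-> L2_inner mu f f < e ^+ 2.
Proof.
move=> Lf e0.
have -> : ('N[mu]_2%:E[EFin \o f] = (Num.sqrt (L2_inner mu f f))%:E)%E.
  rewrite unlock.
  under eq_integral do rewrite /= powR_mulrn// -normrX ger0_norm ?sqr_ge0//.
  by rewrite L2_innerE//= powR12_sqrt// L2_inner_ge0.
rewrite lte_fin -[X in _ < X](ger0_norm (ltW e0)) -sqrtr_sqr.
by rewrite ltr_sqrt// exprn_gt0.
Qed.

Lemma L2_closureE (S : set (T -> R)) f : S `<=` L2 mu ->
  L2_closure mu S f <-> L2 mu f /\ forall e : R, 0 < e ->
    exists2 g, S g & L2_inner mu (fun x => f x - g x) (fun x => f x - g x) < e.
Proof.
move=> SL; split => -[Lf H]; split => // e e0.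
  have [|g Sg] := H (Num.sqrt e); first by rewrite sqrtr_gt0.
  move/Lnorm2_ltP; rewrite sqr_sqrtr ?ltW// sqrtr_gt0 => lt; exists g => //.
  by apply: lt => //; apply: L2B => //; exact: SL.
have [|g Sg lt] := H (e ^+ 2); first by rewrite exprn_gt0.
by exists g => //; apply/Lnorm2_ltP => //; apply: L2B => //; exact: SL.
Qed.

Lemma sub_L2_closure (S : set (T -> R)) : S `<=` L2 mu -> S `<=` L2_closure mu S.
Proof.
move=> SL f Sf; apply/L2_closureE => //; split; first exact: SL.
move=> e e0; exists f => //; rewrite /L2_inner (_ : (fun x => _) = cst 0).
  by rewrite Rintegral_cst// mul0r.
by apply/funext => x; rewrite subrr mulr0.
Qed.

Lemma L2_orth_closure (S : set (T -> R)) : S `<=` L2 mu ->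
  L2_orth mu (L2_closure mu S) = L2_orth mu S.
Proof.
move=> SL; apply/seteqP; split => h [Lh H]; split => // f Sf.
  by apply: H; exact: sub_L2_closure.
have [Lf {}Sf] := (L2_closureE _ SL).1 Sf.
apply/eqP; rewrite -sqrf_eq0 eq_le sqr_ge0 andbT; apply/ler_addgt0Pl => e e0.
rewrite addr0.
(* By Cauchy-Schwarz the squared inner product is at most this tolerance times the squared norm of
   h, hence at most e; the summand 1 keeps the denominator positive. *)
have [|g Sg fg] := Sf (e / (1 + L2_inner mu h h)).
  by rewrite divr_gt0// ltr_pwDl// L2_inner_ge0.
have Lg := SL _ Sg.
have -> : L2_inner mu h f = L2_inner mu h (fun x => f x - g x).
  by rewrite L2_innerBr// (H g Sg) subr0.
apply: (le_trans (L2_cauchy_schwarz Lh (L2B Lf Lg))).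
apply: (@le_trans _ _ (L2_inner mu h h * (e / (1 + L2_inner mu h h)))).
  by apply: ler_wpM2l; [exact: L2_inner_ge0|exact: ltW].
have h0 := L2_inner_ge0 h.
rewrite mulrCA ler_piMr ?(ltW e0)// ler_pdivrMr; lra.
Qed.

Section projection.
Variable S : set (T -> R).
Hypothesis S0 : S (cst 0).

Local Notation sq f := (L2_inner mu f f).

(** The parallelogram law for F - f and F - g: two near-minimizers are close, because their midpoint
    cannot beat the infimum. *)
Lemma L2_inner_midpoint F f g : L2 mu F -> L2 mu f -> L2 mu g ->
  sq (fun x => f x - g x) =
  2 * sq (fun x => F x - f x) + 2 * sq (fun x => F x - g x)
  - 4 * sq (fun x => F x - 2^-1 * (f x + g x)).
Proof.
move=> LF Lf Lg.
have LFf := L2B LF Lf; have LFg := L2B LF Lg; have Lfg := L2D Lf Lg.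
have Lm := L2Z 2^-1 Lfg; have LFm := L2B LF Lm; have Lfmg := L2B Lf Lg.
rewrite !L2_innerBl// !L2_innerBr// !L2_innerZl// !L2_innerZr//.
rewrite !L2_innerDl// !(L2_innerC _ (fun x => f x + g x)) !L2_innerDl//.
rewrite (L2_innerC g f) (L2_innerC g F) (L2_innerC f F).
by field.
Qed.

Lemma L2_minimizing_seq F : L2 mu F -> exists (m : R) (g : (T -> R)^nat),
  [/\ forall h, S h -> m <= sq (fun x => F x - h x),
     forall n, S (g n) &
     forall n, sq (fun x => F x - g n x) <= m + 4^-1 ^+ n].
Proof.
move=> LF; pose V := [set sq (fun x => F x - h x) | h in S].
have V0 : V !=set0 by exists (sq (fun x => F x - (cst 0 : T -> R) x)); exists (cst 0).
have lbV : has_lbound V by exists 0 => _ [h _ <-]; exact: L2_inner_ge0.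
have infV : has_inf V by split.
exists (inf V).
have H n : exists h, S h /\ sq (fun x => F x - h x) <= inf V + 4^-1 ^+ n.
  have [|_ [h Sh <-] lt] := @inf_adherent _ V (4^-1 ^+ n) _ infV.
    by rewrite exprn_gt0.
  by exists h; split => //; exact: ltW.
have [g gP] := choice H.
exists g; split => [h Sh|n|n]; [|by case: (gP n)|by case: (gP n)].
by apply: ge_inf => //; exists h.
Qed.

End projection.

End inner_product.

(** * Completeness of L^2 along geometrically Cauchy sequences, and existence of projections *)

Section fast_cauchy.
Context (R : realType) d (T : measurableType d) (P : probability T R).
Local Notation sq f := (L2_inner P f f).

Lemma fast_cauchy_ae_cvg (C : R) (g : (T -> R)^nat) : 0 <= C ->
  (forall n, L2 P (g n)) ->
  (forall n, sq (fun x => g n.+1 x - g n x) <= C * 4^-1 ^+ n) ->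
  {ae P, forall x, cvgn (g ^~ x)}.
Proof.
move=> C0 Lg gC; pose h (n : nat) (x : T) : R := `|g n.+1 x - g n x|.
have mh n : measurable_fun setT (EFin \o h n).
  apply/measurable_EFinP; apply: measurableT_comp => //.
  by apply: measurable_funB; exact: L2_measurable.
have h0 n x : setT x -> (0 <= (EFin \o h n) x)%E by rewrite /= lee_fin /h normr_ge0.
have ih n : (\int[P]_x (EFin \o h n) x <= ((1 + C) * 2 / (2 ^ n.+1)%:R)%:E)%E.
  have Lgg : L2 P (fun x => g n.+1 x - g n x) by exact: L2B.
  (* The pointwise bound |a| <= 2^-n + 2^n a^2 turns the L^2 estimate C 4^-n into the L^1 estimate
     (1 + C) 2^-n; the latter is written with 2^(n+1) to match [epsilon_trick0]. *)
  apply: (@le_trans _ _ (\int[P]_x ((2^-1 ^+ n)%:E +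
      (2 ^+ n)%:E * ((g n.+1 x - g n x) ^+ 2)%:E))%E).
    apply: ge0_le_integral => //.
    - exact: h0.
    - apply: emeasurable_funD => //; apply: measurable_funeM.
      apply/measurable_EFinP; apply: measurable_funX.
      by apply: measurable_funB; exact: L2_measurable.
    move=> x _; rewrite -EFinM -EFinD lee_fin /h; set a := (_ - _).
    have p0 : (0 : R) < 2 ^+ n by rewrite exprn_gt0.
    rewrite exprVn -(ler_pM2r p0) mulrDl mulVf ?gt_eqF// -real_normK ?num_real//.
    have := sqr_ge0 (2 ^+ n * `|a| - 1); nra.
  rewrite ge0_integralD//; last 2 first.
  - by move=> x _; rewrite -EFinM lee_fin mulr_ge0 ?sqr_ge0 ?exprn_ge0.
  - apply: measurable_funeM; apply/measurable_EFinP; apply: measurable_funX.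
    by apply: measurable_funB; exact: L2_measurable.
  rewrite ge0_integralZl//; last 2 first.
  - apply/measurable_EFinP; apply: measurable_funX.
    by apply: measurable_funB; exact: L2_measurable.
  - by move=> x _; rewrite lee_fin sqr_ge0.
  rewrite L2_innerE// integral_cst// (_ : (P : {measure set T -> \bar R}) setT = 1%E);
    last exact: probability_setT.
  rewrite mule1 -EFinM -EFinD lee_fin.
  apply: (@le_trans _ _ (2^-1 ^+ n + 2 ^+ n * (C * 4^-1 ^+ n))).
    by rewrite lerD2l ler_wpM2l ?exprn_ge0.
  have -> : (4^-1 : R) = 2^-1 * 2^-1 by field.
  rewrite natrX exprS exprMn !exprVn le_eqVlt; apply/orP; left; apply/eqP.
  by field; rewrite expf_eq0 pnatr_eq0 andbF.
have : P.-integrable setT (fun x => \sum_(n <oo) (EFin \o h n) x)%E.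
  apply/integrableP; split; first by apply: ge0_emeasurable_sum => // k x _ _; exact: h0.
  under eq_integral do (rewrite gee0_abs; last by apply: nneseries_ge0 => k _ _; exact: h0).
  rewrite (integral_nneseries P measurableT mh h0).
  apply: (@le_lt_trans _ _ ((1 + C) * 2)%:E); last exact: ltry.
  apply: le_trans (epsilon_trick0 xpredT _); last by rewrite mulr_ge0// addr_ge0.
  by apply: lee_nneseries => // n _ _; apply: integral_ge0 => x; exact: h0.
move/(integrable_ae measurableT); apply: filterS => x /(_ Logic.I) fx.
rewrite (_ : g ^~ x = (fun n => g 0%N x + series (telescope (g ^~ x)) n)); last first.
  by apply/funext => n; rewrite telescopeK /= addrC subrK.
apply: is_cvgD; first exact: is_cvg_cst.
apply: normed_cvg; apply: nondecreasing_is_cvgn.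
  by apply: nondecreasing_series => i _ _; rewrite normr_ge0.
exists (fine (\sum_(n <oo) (EFin \o h n) x)%E) => _ [n _ <-].
rewrite -lee_fin fineK// /series /= -sumEFin.
by apply: nneseries_lim_ge => i _ _; rewrite lee_fin.
Qed.

(* The increments are summable in L^1, which gives an a.e. limit; Fatou's lemma
   then yields the L^2 estimate. *)
Lemma fast_cauchy_cvg (C : R) (g : (T -> R)^nat) : 0 <= C ->
  (forall n, L2 P (g n)) ->
  (forall n m, (n <= m)%N -> sq (fun x => g m x - g n x) <= C * 4^-1 ^+ n) ->
  exists2 q, L2 P q & forall n, sq (fun x => q x - g n x) <= C * 4^-1 ^+ n.
Proof.
(* The upper limit is defined and measurable everywhere, and is the limit almost everywhere. *)
move=> C0 Lg gC; pose q x := fine (limn_esup (fun n => (g n x)%:E)).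
have mq : measurable_fun setT q.
  apply: (measurableT_comp (fine_measurable measurableT)).
  by apply: measurable_fun_limn_esup => n; apply/measurable_EFinP; exact: L2_measurable.
have qP : {ae P, forall x, g ^~ x @ \oo --> q x}.
  have := fast_cauchy_ae_cvg C0 Lg (fun n => gC _ _ (leqnSn n)).
  apply: filterS => x /cvg_ex[/= l gl]; suff -> : q x = l by [].
  have gl' : (fun n => (g n x)%:E) @ \oo --> l%:E by apply: cvg_EFin => //; exact: nearW.
  by rewrite /q is_cvg_limn_esupE ?(cvg_lim _ gl')//; apply/cvg_ex; exists l%:E.
have qg n : (\int[P]_x ((q x - g n x) ^+ 2)%:E <= (C * 4^-1 ^+ n)%:E)%E.
  rewrite (@ge0_ae_eq_integral _ _ _ _ _ _
    (fun x => limn_einf (fun m => ((g m x - g n x) ^+ 2)%:E))) //; last 5 first.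
  - apply/measurable_EFinP; apply: measurable_funX.
    by apply: measurable_funB => //; exact: L2_measurable.
  - rewrite (_ : (fun x => _) = (fun x => - limn_esup (fun m => (- ((g m x - g n x) ^+ 2)%:E)))%E) //.
    apply: measurableT_comp => //; apply: measurable_fun_limn_esup => m.
    apply: measurableT_comp => //; apply/measurable_EFinP; apply: measurable_funX.
    by apply: measurable_funB; exact: L2_measurable.
  - by move=> x _; rewrite lee_fin sqr_ge0.
  - move=> x _; rewrite limn_einf_lim; apply: lime_ge; first exact: is_cvg_einfs.
    by apply: nearW => m; apply: le_ereal_inf_tmp => _ [k _ <-]; rewrite lee_fin sqr_ge0.
  - apply: filterS qP => x gq _.
    rewrite is_cvg_limn_einfE; last first.
      apply/cvg_ex; exists ((q x - g n x) ^+ 2)%:E; apply: cvg_EFin; first exact: nearW.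
      by apply: (@cvg_comp _ _ _ (fun m => g m x - g n x) (fun y => y ^+ 2)
        _ _ _ _ (@exprn_continuous _ 2 _));
      apply: cvgB => //; exact: cvg_cst.
    apply/esym/cvg_lim => //; apply: cvg_EFin; first exact: nearW.
    by apply: (@cvg_comp _ _ _ (fun m => g m x - g n x) (fun y => y ^+ 2)
        _ _ _ _ (@exprn_continuous _ 2 _));
      apply: cvgB => //; exact: cvg_cst.
  apply: le_trans (fatou _ _ _ _) _ => //.
  - move=> m; apply/measurable_EFinP; apply: measurable_funX.
    by apply: measurable_funB; exact: L2_measurable.
  - by move=> m x _; rewrite lee_fin sqr_ge0.
  rewrite limn_einf_lim; apply: lime_le; first exact: is_cvg_einfs.
  (* The infimum over the indices from m on is bounded by its term at max(m, n), where the Cauchy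
     estimate relative to n applies. *)
  apply: nearW => m; apply: ereal_inf_le.
  exists (\int[P]_x ((g (maxn m n) x - g n x) ^+ 2)%:E)%E.
    by exists (maxn m n) => //=; rewrite leq_maxl.
  rewrite L2_innerE; last exact: L2B.
  by rewrite lee_fin; apply: gC; rewrite leq_maxr.
have Lqg n : L2 P (fun x => q x - g n x).
  have mqg : measurable_fun setT (fun x => q x - g n x).
    by apply: measurable_funB => //; exact: L2_measurable.
  apply/L2P; split => //; apply/integrableP; split.
    by apply/measurable_EFinP; exact: measurable_funX.
  under eq_integral do rewrite gee0_abs ?lee_fin ?sqr_ge0//.
  exact: le_lt_trans (qg n) (ltry _).
exists q => [|n]; last by have := qg n; rewrite L2_innerE// lee_fin.
rewrite (_ : q = fun x => (q x - g 0%N x) + g 0%N x); first exact: L2D.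
by apply/funext => x; rewrite subrK.
Qed.

Lemma geometric4_lt (c e : R) : 0 < e -> exists n, c * 4^-1 ^+ n < e.
Proof.
move=> e0; have /(@cvg_geometric _ c)/cvgr_lt/(_ _ e0)[n _ H] : `|4^-1 : R| < 1.
  by rewrite ger0_norm ?invr_ge0// invf_lt1// ltr1n.
by exists n; apply: H => /=.
Qed.

Lemma L2_proj_exists (S : set (T -> R)) (F : T -> R) : S `<=` L2 P ->
  S (cst 0) -> (forall a f g, S f -> S g -> S (fun x => f x + a * g x)) ->
  L2 P F -> exists2 q, L2_closure P S q & L2_orth P S (fun x => F x - q x).
Proof.
move=> SL S0 SDZ LF; have [m [g [mP Sg gm]]] := L2_minimizing_seq S0 LF.
have Lg n := SL _ (Sg n).
have gC n k : (n <= k)%N -> sq (fun x => g k x - g n x) <= 4 * 4^-1 ^+ n.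
  (* With the midpoint at squared distance at least m, the bound is 2 (m + 4^-k) + 2 (m + 4^-n) - 4
     m, at most 4 times 4^-n. *)
  move=> nk; rewrite (L2_inner_midpoint LF)//.
  have Smid : S (fun x => 2^-1 * (g k x + g n x)).
    rewrite (_ : (fun x => _) = (fun x => ((cst 0 : T -> R) x + 2^-1 * g k x) + 2^-1 * g n x)).
      exact: SDZ (SDZ _ _ _ S0 (Sg k)) (Sg n).
    by apply/funext => x /=; rewrite add0r mulrDr.
  have := mP _ Smid; have := gm n; have := gm k.
  have : (4^-1 ^+ k : R) <= 4^-1 ^+ n.
    by apply: ler_wiXn2l => //; rewrite invf_le1// ler1n.
  lra.
have [//|q Lq qg] := fast_cauchy_cvg _ Lg gC; exists q.
  apply/L2_closureE => //; split => // e e0.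
  have [n ne] := geometric4_lt 4 e0.
  by exists (g n) => //; exact: le_lt_trans (qg n) ne.
have LFq : L2 P (fun x => F x - q x) by exact: L2B.
split => // h Sh; have Lh := SL _ Sh.
(* From (a - b)^2 <= 2 a^2 + 2 b^2, where a^2 and b^2 are bounded by 1 and 4 times the common
   factor: 2 + 8 = 10. *)
have bnd n : L2_inner P (fun x => F x - q x) h ^+ 2 <= 10 * sq h * 4^-1 ^+ n.
  have LFg : L2 P (fun x => F x - g n x) by exact: L2B.
  have Lqg : L2 P (fun x => q x - g n x) by exact: L2B.
  have -> : L2_inner P (fun x => F x - q x) h =
      L2_inner P (fun x => F x - g n x) h - L2_inner P (fun x => q x - g n x) h.
    by rewrite !L2_innerBl//; ring.
  have H1 : L2_inner P (fun x => F x - g n x) h ^+ 2 <= 4^-1 ^+ n * sq h.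
    apply: sqr_le_discriminant; first exact: L2_inner_ge0.
    move=> t; have := L2_inner_subZ t LFg Lh.
    have := mP _ (SDZ t _ _ (Sg n) Sh); have := gm n.
    rewrite (_ : (fun x => F x - (g n x + t * h x)) = (fun x => F x - g n x - t * h x)).
      by lra.
    by apply/funext => x; rewrite opprD addrA.
  have H2 : L2_inner P (fun x => q x - g n x) h ^+ 2 <= 4 * 4^-1 ^+ n * sq h.
    apply: le_trans (L2_cauchy_schwarz Lqg Lh) _.
    by apply: ler_wpM2r (qg n); exact: L2_inner_ge0.
  move: H1 H2; set a := L2_inner _ _ _; set b := L2_inner _ _ _.
  have := sqr_ge0 (a + b); nra.
apply/eqP; rewrite -sqrf_eq0 eq_le sqr_ge0 andbT; apply/ler_addgt0Pl => e e0.
have [n /ltW ne] := geometric4_lt (10 * sq h) e0.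
by rewrite addr0; exact: le_trans (bnd n) ne.
Qed.

End fast_cauchy.

(** * Configurations as sums of Dirac masses *)

Section sums_of_diracs.
Context (R : realType) d (E : measurableType d).
Implicit Types (s : seq E) (eta : Nfin R E).

Definition diracs_seq s : Nfin R E := diracs R (in_tuple s).

Lemma diracs_seqE s (A : set E) : measurable A ->
  (diracs_seq s A = \sum_(y <- s) \d_y A :> \bar R)%E.
Proof. by move=> mA; rewrite diracsE// [RHS]big_tnth. Qed.

Lemma diracs_seq_count s (A : set E) : measurable A ->
  diracs_seq s A = (count (fun y => y \in A) s)%:R%:E :> \bar R.
Proof.
move=> mA; rewrite diracs_seqE//; elim: s => [|y s IH]; first by rewrite big_nil.
by rewrite big_cons IH diracE /= natrD EFinD.
Qed.

Lemma diracs_seq_size s : diracs_seq s setT = (size s)%:R%:E :> \bar R.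
Proof.
rewrite diracs_seq_count//; congr (_%:R%:E); apply/eqP.
by rewrite -all_count; apply/allP => y; rewrite in_setT.
Qed.

Lemma diracs_diracs_seq n (x : n.-tuple E) : diracs R x = diracs_seq x.
Proof. by apply: nfin_ext => A mA; rewrite diracs_seqE// diracsE// big_tuple. Qed.

Lemma diracs_seq_perm s s' : perm_eq s s' -> diracs_seq s = diracs_seq s'.
Proof. by move=> ss'; apply: nfin_ext => A mA; rewrite !diracs_seqE//; exact: perm_big. Qed.

Lemma integral_diracs_seq s (f : E -> R) : measurable_fun setT f ->
  (\int[diracs_seq s]_x (f x)%:E = (\sum_(y <- s) f y)%:E)%E.
Proof.
move=> mf.
have H (g : E -> \bar R) : (forall x, 0 <= g x)%E -> measurable_fun setT g ->
    (\int[diracs_seq s]_x g x = \sum_(y <- s) g y)%E.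
  move=> g0 mg.
  rewrite (eq_measure_integral (msum (fun i => \d_(nth point s i)) (size s))).
    rewrite ge0_integral_measure_sum// [RHS](big_nth point) big_mkord.
    by apply: eq_bigr => i _; rewrite integral_dirac// diracT mul1e.
  by move=> A mA _; rewrite [LHS]diracs_seqE//= (big_nth point) big_mkord.
rewrite integralE !H//; last 2 first.
- by apply: measurable_funeneg; exact/measurable_EFinP.
- by apply: measurable_funepos; exact/measurable_EFinP.
under eq_bigr do rewrite funeposE -EFin_max.
under [X in (_ - X)%E]eq_bigr do rewrite funenegE -EFinN -EFin_max.
rewrite !sumEFin -EFinB -sumrB; congr EFin; apply: eq_bigr => y _.
rewrite /Order.max; case: ifPn; case: ifPn; lra.
Qed.

Lemma Rintegral_diracs_seq s (f : E -> R) : measurable_fun setT f ->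
  \int[diracs_seq s]_x f x = \sum_(y <- s) f y.
Proof. by move=> mf; rewrite /Rintegral integral_diracs_seq. Qed.

Lemma measurable_eval (B : set E) : measurable B ->
  measurable_fun setT (fun eta : Nfin R E => eta B : \bar R).
Proof.
move=> mB _ Y mY; rewrite setTI; apply: sub_sigma_algebra.
by exists B => //; exists Y => //; rewrite setTI.
Qed.

Lemma measurable_nfin d' (T : measurableType d') (f : T -> Nfin R E) :
  (forall B, measurable B -> measurable_fun setT (fun x => f x B : \bar R)) ->
  measurable_fun setT f.
Proof.
move=> mf; apply: (@measurability _ _ _ _ _ _ (\bigcup_(B in measurable)
  preimage_set_system setT (fun eta : Nfin R E => eta B : \bar R) measurable)) => //.
move=> _ [_ [B mB [Y mY <-]] <-]; rewrite !setTI.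
by rewrite -[X in measurable X]setTI; exact: mf.
Qed.

Lemma measurable_diracs n : measurable_fun setT (fun x : n.-tuple E => diracs R x).
Proof.
apply: measurable_nfin => B mB.
rewrite (_ : (fun x => _) = fun x => (\sum_(i < n) (\1_B (tnth x i))%:E)%E); last first.
  by apply/funext => x; rewrite diracsE//; apply: eq_bigr => i _; rewrite diracE indicE.
apply: emeasurable_sum => i; apply/measurable_EFinP.
by apply: measurableT_comp; [exact: measurable_indic|exact: measurable_tnth].
Qed.

Definition level n : set (Nfin R E) := [set eta | eta setT = n%:R%:E :> \bar R].

Lemma measurable_level n : measurable (level n).
Proof.
rewrite (_ : level n = (fun eta : Nfin R E => eta setT : \bar R) @^-1` [set n%:R%:E]); last by [].
rewrite -[X in measurable X]setTI; exact: (measurable_eval measurableT).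
Qed.

Lemma bigcup_level : \bigcup_n level n = setT.
Proof.
by apply/seteqP; split => // eta _; have [n en] := nfin_nat eta measurableT; exists n.
Qed.

End sums_of_diracs.

(** * Measurable enumeration of the atoms *)

Section borel.
Context (R : realType) d (E : measurableType d).
Variable phi : E -> R.
Hypotheses (mphi : measurable_fun setT phi) (iphi : injective phi)
  (phi01 : forall x, 0 <= phi x <= 1)
  (phiim : forall A : set E, measurable A -> measurable (phi @` A)).
Implicit Types eta : Nfin R E.

Lemma borel_measurable_set1 (x : E) : measurable [set x].
Proof.
rewrite (_ : [set x] = setT `&` phi @^-1` [set phi x]); first exact: mphi.
by apply/seteqP; split => y /=; [move->|move=> [_ /iphi]].
Qed.

Let above (q : R) : set E := phi @^-1` `[q, +oo[.

Let mabove q : measurable (above q).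
Proof. by rewrite -[X in measurable X]setTI; exact: mphi. Qed.

Let le_above q r eta : q <= r -> (eta (above r) <= eta (above q))%E.
Proof.
move=> qr; apply: le_measure; rewrite ?inE//.
by move=> y; rewrite /above /= !in_itv/= !andbT; exact: le_trans.
Qed.

(* The values under [phi] of the atoms of [eta] in decreasing order, counted with
   multiplicity and continued by [phi point]. *)
Definition quantile k eta : R :=
  if (k.+1%:R%:E <= eta setT)%E then
    sup [set q : R | (k.+1%:R%:E <= eta (above q))%E]
  else phi point.

(** The content is that the supremum is attained: the half-lines starting at [sup S] - 1/(n+1)
    decrease to the one starting at [sup S], and a finite measure is continuous from above. *)
Lemma quantile_ge k eta q : (k.+1%:R%:E <= eta setT)%E ->
  (q <= quantile k eta) = (k.+1%:R%:E <= eta (above q))%E.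
Proof.
move=> kN; rewrite /quantile kN; set S := [set q | _].
have S0 : S 0.
  rewrite /S /= (_ : above 0 = setT)//; apply/seteqP; split => // y _.
  by rewrite /above /= in_itv/= andbT; case/andP: (phi01 y).
have ubS : has_ubound S.
  exists 1 => r; apply: contraTT; rewrite -ltNge => r1.
  rewrite (_ : above r = set0) ?measure0 -?ltNge ?lte_fin//.
  apply/seteqP; split => // y; rewrite /above /= in_itv/= andbT => ry.
  by case/andP: (phi01 y) => _ /(le_trans ry); rewrite leNgt r1.
have hS : has_sup S by split => //; exists 0.
have Ssup : S (sup S).
  pose a n : R := sup S - n.+1%:R^-1.
  have aS n : (k.+1%:R%:E <= eta (above (a n)))%E.
    have [|r Sr lt] := @sup_adherent _ S n.+1%:R^-1 _ hS; first by rewrite invr_gt0.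
    by apply: le_trans Sr _; apply: le_above; exact: ltW.
  have cap : \bigcap_n above (a n) = above (sup S).
    apply/seteqP; split => y; rewrite /above /=.
      move=> H; rewrite in_itv/= andbT; apply/ler_addgt0Pl => e e0.
      have [n _ /(_ n (leqnn n)) ne] := near_infty_natSinv_lt (PosNum e0).
      have := H n Logic.I; rewrite /above /= in_itv/= andbT /a lerBlDr.
      by move=> /le_trans; apply; rewrite addrC lerD2r ltW.
    rewrite !in_itv/= !andbT => H n _; rewrite /above /= in_itv/= andbT.
    by apply: le_trans H; rewrite /a gerBl.
  have : eta \o (fun n => above (a n)) @ \oo --> eta (\bigcap_n above (a n)).
    apply: nonincreasing_cvg_mu => //.
    - by rewrite -ge0_fin_numE// fin_num_measure.
    - by rewrite cap.
    - move=> m n mn; apply/subsetPset => y; rewrite /above /= !in_itv/= !andbT.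
      apply: le_trans; rewrite /a lerD2l lerN2 lef_pV2 ?posrE// ler_nat ltnS; exact: mn.
  rewrite cap => H; rewrite /S /= -(cvg_lim _ H)//.
  by apply: lime_ge; [apply/cvg_ex; eexists; exact: H|exact: nearW].
apply/idP/idP => [qS|Sq]; last exact: ub_le_sup.
by apply: le_trans Ssup _; exact: le_above.
Qed.

Lemma measurable_quantile k : measurable_fun setT (quantile k).
Proof.
apply: (measurability _ (RGenCInfty.measurableE R)) => _ [_ [q ->] <-].
rewrite setTI; have -> : (quantile k @^-1` `[q, +oo[ =
  [set eta | (k.+1%:R%:E <= eta setT)%E] `&` [set eta | (k.+1%:R%:E <= eta (above q))%E] `|`
  if q <= phi point then ~` [set eta | (k.+1%:R%:E <= eta setT)%E] else set0)%classic.
  apply/seteqP; split => eta /=; rewrite in_itv/= andbT.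
    have [kN|kN] := boolP (k.+1%:R%:E <= eta setT)%E; first by rewrite quantile_ge//; left.
    rewrite /quantile (negbTE kN); case: (q <= _) => // _.
    by right; apply/negP.
  move=> [[kN]|]; first by rewrite quantile_ge.
  case: ifPn => // qp /negP kN; by rewrite /quantile (negbTE kN).
have mc B : measurable B -> measurable [set eta : Nfin R E | (k.+1%:R%:E <= eta B)%E].
  move=> mB; rewrite -[X in measurable X]setTI.
  exact: (emeasurable_fun_c_infty measurableT (measurable_eval mB)).
apply: measurableU.
  by apply: measurableI; exact: mc.
case: (q <= phi point); last exact: measurable0.
by apply: measurableC; exact: mc.
Qed.

Let sum_ltn m N : (\sum_(k < N) (k < m) = minn m N)%N.
Proof.
elim: N => [|N IH]; first by rewrite big_ord0 minn0.
by rewrite big_ord_recr /= IH; lia.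
Qed.

(** Closed upper half-lines are stable under intersection and generate the Borel sets, so it
    suffices to compare the two measures on them. *)
Lemma pushforward_quantile eta N : eta setT = N%:R%:E :> \bar R ->
  forall A : set R, measurable A ->
  (eta (phi @^-1` A) = \sum_(k < N) \d_(quantile k eta) A)%E.
Proof.
move=> eN A mA.
have @m1 : {measure set R -> \bar R} by refine (pushforward eta phi); exact: mphi.
pose m2 : {measure set R -> \bar R} := msum (fun k => \d_(quantile k eta)) N.
suff : m1 A = m2 A by [].
apply: (measure_unique (@RGenCInfty.G R) (fun n => `[- n%:R, +oo[%classic)) => //.
- exact: RGenCInfty.measurableE.
- move=> _ _ [x ->] [y ->]; exists (Num.max x y).
  by apply/seteqP; split => z /=; rewrite !in_itv/= !andbT ge_max => /andP.
- by move=> n; exists (- n%:R).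
- apply/seteqP; split => // x _; exists (Num.truncn `|x|).+1 => //=.
  rewrite in_itv/= andbT lerNl; apply: le_trans (ltW (truncnS_gt _)).
  by rewrite -normrN ler_norm.
- move=> _ [q ->]; rewrite /m1 /m2 /= /pushforward /msum.
  have [m em] := nfin_nat eta (mabove q); rewrite /above in em; rewrite em.
  have mN : (m <= N)%N.
    rewrite -(ler_nat R) -lee_fin -em -eN; apply: le_measure; rewrite ?inE//; exact: mabove.
  (* A half-line of mass m contains exactly the quantiles of index k < m. *)
  transitivity ((\sum_(k < N) (k < m))%N%:R%:E : \bar R).
    by rewrite sum_ltn (minn_idPl mN).
  rewrite natr_sum -sumEFin; apply: eq_bigr => k _.
  rewrite [RHS]diracE; congr ((nat_of_bool _)%:R%:E); rewrite mem_setE in_itv/= andbT.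
  by rewrite quantile_ge /above ?em ?eN lee_fin ler_nat.
- move=> n; rewrite /m1 /= /pushforward -ge0_fin_numE//; apply: fin_num_measure; exact: mabove.
Qed.

(** The complement of the range of phi is Borel and has no mass under the image of eta, so no
    genuine quantile lies there; the default [phi point] is in the range as well. *)
Lemma quantile_range k eta : range phi (quantile k eta).
Proof.
have [N eN] := nfin_nat eta measurableT.
have [kN|kN] := boolP (k.+1%:R%:E <= eta setT)%E; last first.
  by rewrite /quantile (negbTE kN); exists point.
move: (kN); rewrite eN lee_fin ler_nat => kltN.
have mr : measurable (range phi) by exact: phiim.
have := pushforward_quantile eN (measurableC mr).
rewrite (_ : phi @^-1` _ = set0); last first.
  by apply/seteqP; split => // y /= H; apply: H; exists y.
rewrite measure0 => /esym/eqP; rewrite seq_psume_eq0; last by move=> *; exact: measure_ge0.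
move=> /allP/(_ (Ordinal kltN)); rewrite mem_index_enum => /(_ isT)/=.
rewrite diracE; case: (boolP (_ \in _)) => /=; first by rewrite onee_eq0.
by rewrite notin_setE => /contrapT.
Qed.

Definition atom k eta : E := xget point (fun y => phi y = quantile k eta).

Lemma phi_atom k eta : phi (atom k eta) = quantile k eta.
Proof.
have [y _ py] := quantile_range k eta.
by rewrite /atom; case: xgetP => [z ->//|/(_ y)].
Qed.

(** Here the inverse of phi must be measurable, i.e. phi must map measurable sets to Borel sets. *)
Lemma measurable_atom k : measurable_fun setT (atom k).
Proof.
move=> _ A mA; rewrite setTI (_ : _ @^-1` _ = setT `&` quantile k @^-1` (phi @` A)).
  by apply: measurable_quantile => //; exact: phiim.
apply/seteqP; split => eta /=; rewrite -phi_atom.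
  by move=> Aa; split => //; exists (atom k eta).
by move=> [_ [y Ay /iphi <-]].
Qed.

Lemma nfin_atoms eta N : eta setT = N%:R%:E :> \bar R ->
  eta = diracs R [tuple atom k eta | k < N].
Proof.
move=> eN; apply: nfin_ext => A mA; rewrite diracsE//.
rewrite (_ : A = phi @^-1` (phi @` A)); last first.
  by apply/seteqP; split => [y Ay|y [z Az /iphi <-//]]; exists y.
rewrite (pushforward_quantile eN); last exact: phiim.
apply: eq_bigr => i _; rewrite tnth_mktuple !diracE -phi_atom.
by congr ((nat_of_bool _)%:R%:E); apply/idP/idP; rewrite !inE.
Qed.

End borel.

(** * Lowering operator and tensor powers on sums of Dirac masses *)

Section borel_nfin.
Context (R : realType) d (E : measurableType d).
Hypothesis hE : borel_space R E.
Implicit Types (eta : Nfin R E) (s : seq E).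

Lemma borel_set1 (x : E) : measurable [set x].
Proof. by have [phi [mphi iphi _ _]] := hE; exact: borel_measurable_set1 mphi iphi x. Qed.

Lemma measurable_diracs_seq n : measurable_fun setT (fun x : n.-tuple E => diracs_seq R x).
Proof.
rewrite (_ : (fun x => _) = fun x : n.-tuple E => diracs R x).
  exact: measurable_diracs.
by apply/funext => x; rewrite diracs_diracs_seq.
Qed.

Lemma in_set1E (x y : E) : (y \in [set x]) = (y == x).
Proof. by apply/idP/eqP; rewrite inE. Qed.

Lemma nfin_diracs_seq eta : exists s, eta = diracs_seq R s.
Proof.
have [phi [mphi iphi phi01 phiim]] := hE.
have [N eN] := nfin_nat eta measurableT.
rewrite (nfin_atoms mphi iphi phi01 phiim eN) diracs_diracs_seq.
by eexists; reflexivity.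
Qed.

(** On each of the countably many levels, eta is recovered from its atoms, which depend measurably
    on eta. *)
Lemma measurable_nfin_fun (G : Nfin R E -> R) :
  (forall N, measurable_fun setT (fun x : N.-tuple E => G (diracs R x))) ->
  measurable_fun setT G.
Proof.
have [phi [mphi iphi phi01 phiim]] := hE.
move=> mG; rewrite -(bigcup_level R E).
apply/measurable_fun_bigcup => N; first exact: measurable_level.
apply: (eq_measurable_fun (fun eta => G (diracs R [tuple atom phi k eta | k < N]))).
  by move=> eta; rewrite inE => eN; rewrite -(nfin_atoms mphi iphi phi01 phiim eN).
apply: measurable_funTS; apply: (measurableT_comp (mG N)).
apply/measurable_fun_tnthP => i; rewrite /comp.
under eq_fun do rewrite tnth_mktuple.
exact: (measurable_atom mphi iphi phi01 phiim).
Qed.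

Lemma remove_diracs_seq s y : y \in s -> remove (diracs_seq R s) y = diracs_seq R (rem y s).
Proof.
move=> ys.
have H A : measurable A -> (diracs_seq R (rem y s) A + \d_y A = diracs_seq R s A)%E.
  move=> mA; rewrite [in RHS](diracs_seq_perm R (perm_to_rem ys)) !diracs_seqE// big_cons addeC.
  by [].
rewrite /remove; case: xgetP => [xi _ xiP|/(_ (diracs_seq R (rem y s)))]; last by case.
apply: nfin_ext => A mA; have := xiP A mA; rewrite -H// diracE.
have := @fin_num_measure _ _ _ xi A mA.
have := @fin_num_measure _ _ _ (diracs_seq R (rem y s)) A mA.
by case: (xi A) => // a; case: (diracs_seq R _ A) => // b _ _ [] /addIr ->.
Qed.

Lemma remove_notin s y : y \notin s -> remove (diracs_seq R s) y = nfin0 R E.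
Proof.
move=> ys; rewrite /remove; case: xgetP => [xi _ /(_ _ (borel_set1 y))|//].
rewrite diracE mem_set// diracs_seq_count; last exact: borel_set1.
rewrite (_ : count _ s = 0%N); last first.
  apply/eqP; rewrite -leqn0 leqNgt -has_count; apply: contra ys.
  by move=> /hasP[z zs]; rewrite in_set1E => /eqP <-.
move=> h; have : (1 <= xi [set y] + 1%:R%:E)%E by rewrite leeDr.
by rewrite h lee_fin ler10.
Qed.

(** Meant for the integrand of [lowering], which is constant off the atoms because [remove] falls
    back on [nfin0] there. *)
Lemma measurable_off_finite s (f : E -> R) (c : R) :
  (forall y, y \notin s -> f y = c) -> measurable_fun setT f.
Proof.
elim: s f => [|x s IH] f fc.
  by rewrite (_ : f = cst c)//; apply/funext => y; rewrite fc.
rewrite (_ : f = fun y => if y == x then f x else if y \in s then f y else c); last first.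
  apply/funext => y; case: eqP => [->//|/eqP yx]; case: ifPn => // ys.
  by rewrite fc// inE negb_or yx.
apply: measurable_fun_if => //.
- apply: (@measurable_fun_bool _ _ _ _ true).
  rewrite setTI (_ : _ @^-1` _ = [set x]); first exact: borel_set1.
  by apply/seteqP; split => y /= /eqP.
- apply: measurable_funTS; apply: IH => y ys; by rewrite (negbTE ys).
Qed.

Lemma lowering_diracs_seq (G : Nfin R E -> R) s :
  lowering G (diracs_seq R s) = lower_seq (fun l => G (diracs_seq R l)) s.
Proof.
rewrite /lowering Rintegral_diracs_seq; last first.
  apply: (@measurable_off_finite s _ (G (nfin0 R E))) => y ys.
  by rewrite remove_notin.
rewrite lower_seq_rem; last by move=> l l' ll'; rewrite (diracs_seq_perm R ll').
by apply: eq_big_seq => y ys; rewrite remove_diracs_seq.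
Qed.

Lemma measurable_lowering (G : Nfin R E -> R) : measurable_fun setT G ->
  measurable_fun setT (lowering G).
Proof.
move=> mG; apply: measurable_nfin_fun => N.
rewrite (_ : (fun x => _) = fun x : N.-tuple E =>
    \sum_(i < N) G (diracs_seq R (del_at i x))); last first.
  by apply/funext => x; rewrite diracs_diracs_seq lowering_diracs_seq /lower_seq size_tuple.
apply: measurable_sum => i; apply: (measurableT_comp mG).
apply: measurable_nfin => B mB.
rewrite (_ : (fun x => _) = fun x : N.-tuple E => (diracs_seq R x B - \d_(tnth x i) B)%E).
  apply: emeasurable_funB.
    apply: (@measurableT_comp _ _ _ _ _ _ (fun eta : Nfin R E => eta B : \bar R)).
      exact: measurable_eval.
    exact: measurable_diracs_seq.
  apply: (@measurableT_comp _ _ _ _ _ _ (fun y => \d_y B)); last exact: measurable_tnth.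
  under eq_fun do rewrite diracE.
  apply/measurable_EFinP; exact: measurable_indic.
apply/funext => x; have ix : (i < size x)%N by rewrite size_tuple.
have /(perm_del_at point) := ix => /(diracs_seq_perm R) <-.
rewrite -tnth_nth.
rewrite [in RHS]diracs_seqE// big_cons -diracs_seqE// diracE diracs_seq_count//.
by rewrite addeAC subee// add0e.
Qed.


(** The passage from functions of k points to functions on lists, where [powsum] and the differences
    live. *)
Definition tuple_fun k (f : k.-tuple E -> R) (l : seq E) : R :=
  oapp f 0 (insub l).

Lemma tuple_fun_tuple k (f : k.-tuple E -> R) (x : k.-tuple E) :
  tuple_fun f x = f x.
Proof. by rewrite /tuple_fun valK. Qed.

Lemma tuple_fun_size k (f : k.-tuple E -> R) (l : seq E) (lk : size l = k) :
  tuple_fun f l = f (Tuple (introT eqP lk)).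
Proof. by rewrite -tuple_fun_tuple. Qed.

Lemma tuple_fun_cons k (f : k.+1.-tuple E -> R) y l :
  tuple_fun f (y :: l) = tuple_fun (fun t : k.-tuple E => f [tuple of y :: t]) l.
Proof.
have [lk|lk] := eqVneq (size l) k.
  have lk' : size (y :: l) = k.+1 by rewrite /= lk.
  by rewrite (tuple_fun_size _ lk) (tuple_fun_size _ lk'); congr f; exact: val_inj.
by rewrite /tuple_fun !insubN// /= eqSS.
Qed.

Lemma bounded_measurable_integrable d' (T : measurableType d')
    (mu : {measure set T -> \bar R}) (f : T -> R) : (mu setT < +oo)%E ->
  bounded_measurable f -> mu.-integrable setT (EFin \o f).
Proof.
move=> muT [mf [M fM]]; apply: measurable_bounded_integrable => //.
exists M; split; first exact: num_real.
by move=> x Mx y _ /=; rewrite (le_trans (fM y))// ltW.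
Qed.

Lemma integral_mcons k (m1 : {finite_measure set E -> \bar R})
    (m2 : {finite_measure set (k.-tuple E) -> \bar R}) (f : k.+1.-tuple E -> R) :
  bounded_measurable f ->
  measurable_fun setT (fun x => \int[m2]_y (f [tuple of x :: y])%:E)%E /\
  (\int[mcons m1 m2]_z (f z)%:E =
   \int[m1]_x \int[m2]_y (f [tuple of x :: y])%:E)%E.
Proof.
move=> bf; have [mf [M fM]] := bf.
have mfc : measurable_fun setT (f \o (@tuple_cons _ E k)).
  by apply: measurableT_comp => //; exact: measurable_tuple_cons.
have ifc : (m1 \x m2)%E.-integrable setT (EFin \o (f \o (@tuple_cons _ E k))).
  apply: bounded_measurable_integrable; last by split => //; exists M => x; exact: fM.
  have := fin_num_measure (mcons m1 m2) setT measurableT.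
  by rewrite ge0_fin_numE//; rewrite /= /mcons /pushforward preimage_setT.
split; first exact: (measurable_fubini_F ifc).
rewrite -[RHS]/(\int[m1]_x (fubini_F m2 (EFin \o (f \o (@tuple_cons _ E k))) x))%E.
rewrite (integral12_prod_meas1 ifc).
have := @integral_pushforward _ _ _ _ _ _ (@measurable_tuple_cons _ E k) (m1 \x m2)%E setT
  (EFin \o f) _ ifc measurableT.
by rewrite preimage_setT => <- //; apply/measurable_EFinP.
Qed.

Lemma bounded_measurable_cons k (f : k.+1.-tuple E -> R) (x : E) :
  bounded_measurable f ->
  bounded_measurable (fun y : k.-tuple E => f [tuple of x :: y]).
Proof.
move=> [mf [M fM]]; split; last by exists M.
by apply: (measurableT_comp mf); exact: measurable_cons.
Qed.

Lemma tensor_diracs_seq k (f : k.-tuple E -> R) s : bounded_measurable f ->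
  tensor (diracs_seq R s) f = powsum k (tuple_fun f) s.
Proof.
move=> bf; rewrite /tensor /Rintegral.
(* The induction runs on extended real integrals, the form in which Fubini presents the inner
   integral. *)
suff -> : (\int[mpow (diracs_seq R s) k]_x (f x)%:E = (powsum k (tuple_fun f) s)%:E)%E by [].
elim: k f bf => [|k IH] f bf.
  rewrite integral_dirac//; last by apply/measurable_EFinP; case: bf.
  by rewrite diracT mul1e /= -tuple_fun_tuple.
have H x : (\int[mpow (diracs_seq R s) k]_y (f [tuple of x :: y])%:E =
    (powsum k (fun l => tuple_fun f (x :: l)) s)%:E)%E.
  rewrite (IH _ (bounded_measurable_cons x bf)); congr EFin.
  by congr (powsum k _ s); apply/funext => l; rewrite tuple_fun_cons.
have [mF ->] := integral_mcons (diracs_seq R s) (mpow (diracs_seq R s) k) bf.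
under eq_integral do rewrite H.
rewrite integral_diracs_seq//; apply/measurable_EFinP; apply: eq_measurable_fun mF => x _.
by rewrite H.
Qed.

Lemma measurable_rcons d' (T : measurableType d') n (v : T -> n.-tuple E) (u : T -> E) :
  measurable_fun setT v -> measurable_fun setT u ->
  measurable_fun setT (fun w => [tuple of rcons (v w) (u w)] : n.+1.-tuple E).
Proof.
move=> mv mu; apply/measurable_fun_tnthP => i; rewrite /comp.
have [ilt|ige] := ltnP i n.
  rewrite (_ : (fun w => _) = fun w => tnth (v w) (Ordinal ilt)).
    apply: (@measurableT_comp _ _ _ _ _ _ (fun t : n.-tuple E => tnth t (Ordinal ilt))) => //.
    exact: measurable_tnth.
  by apply/funext => w; rewrite !(tnth_nth point) /= nth_rcons size_tuple ilt.
rewrite (_ : (fun w => _) = u) //; apply/funext => w.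
have -> : i = ord_max by apply: val_inj; apply/eqP; rewrite eqn_leq -ltnS ltn_ord.
by rewrite (tnth_nth point) /= nth_rcons size_tuple ltnn eqxx.
Qed.

(** The induction moves the summation variables one by one into the prefix [v], which is therefore
    arbitrary; a final prefix of length other than m yields the constant 0. *)
Lemma measurable_powsum k m j N d' (T : measurableType d') (f : m.-tuple E -> R)
    (v : T -> j.-tuple E) (u : T -> N.-tuple E) :
  measurable_fun setT f -> measurable_fun setT v -> measurable_fun setT u ->
  measurable_fun setT (fun w => powsum k (fun l => tuple_fun f (v w ++ l)) (u w)).
Proof.
move=> mf + mu; elim: k j v => [|k IH] j v mv.
  have [jm|jm] := eqVneq j m.
    subst m; apply: (@eq_measurable_fun _ _ _ _ _ (f \o v)); last exact: measurableT_comp.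
    by move=> w _; rewrite /= cats0 tuple_fun_tuple.
  apply: (@eq_measurable_fun _ _ _ _ _ (cst 0 : T -> R)) => // w _.
  by rewrite /= cats0 /tuple_fun insubN// size_tuple.
rewrite [X in measurable_fun _ X](_ : _ = fun w =>
  \sum_(i < N) powsum k (fun l => tuple_fun f (v w ++ tnth (u w) i :: l)) (u w)); last first.
  by apply/funext => w; rewrite /= big_tuple.
apply: measurable_sum => i.
have mui : measurable_fun setT (fun w => tnth (u w) i).
  apply: (@measurableT_comp _ _ _ _ _ _ (fun t : N.-tuple E => tnth t i)) => //.
  exact: measurable_tnth.
have := IH _ _ (measurable_rcons mv mui).
apply: eq_measurable_fun => w _; congr (powsum k _ _); apply/funext => l.
by rewrite /= cat_rcons.
Qed.

Lemma measurable_tensor k (f : k.-tuple E -> R) : bounded_measurable f ->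
  measurable_fun setT (fun eta : Nfin R E => tensor eta f).
Proof.
move=> bf; apply: measurable_nfin_fun => N.
under eq_fun do rewrite diracs_diracs_seq tensor_diracs_seq//.
have mc : measurable_fun setT (cst [tuple] : N.-tuple E -> 0.-tuple E) by [].
by have [mf _] := bf; exact: (measurable_powsum k mf mc (@measurable_id _ _ _)).
Qed.

End borel_nfin.

(** * Polynomials *)

Section level_bounded.
Context (R : realType) d (E : measurableType d).
Hypothesis hE : borel_space R E.
Implicit Types (F G : Nfin R E -> R) (eta : Nfin R E) (s : seq E).

(** The working class of functions: it contains the unbounded polynomials and is stable under
    [lowering], [exp_lowering] and, for a conservative process, the semigroup. *)
Definition level_bounded F : Prop := measurable_fun setT F /\
  forall n, exists M, forall s, size s = n -> `|F (diracs_seq R s)| <= M.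

Lemma nfin_fun_eq F G : (forall s, F (diracs_seq R s) = G (diracs_seq R s)) -> F = G.
Proof. by move=> FG; apply/funext => eta; have [s ->] := nfin_diracs_seq hE eta. Qed.

Lemma level_boundedD F G : level_bounded F -> level_bounded G ->
  level_bounded (fun eta => F eta + G eta).
Proof.
move=> [mF bF] [mG bG]; split; first exact: measurable_funD.
move=> n; have [M FM] := bF n; have [M' GM] := bG n.
exists (M + M') => s sn; apply: (le_trans (ler_normD _ _)).
by apply: lerD; [exact: FM|exact: GM].
Qed.

Lemma level_boundedZ a F : level_bounded F -> level_bounded (fun eta => a * F eta).
Proof.
move=> [mF bF]; split; first exact: measurable_funM.
move=> n; have [M FM] := bF n; exists (`|a| * M) => s sn.
by rewrite normrM ler_wpM2l// FM.
Qed.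

Lemma level_bounded_sum m (F : 'I_m -> Nfin R E -> R) :
  (forall i, level_bounded (F i)) -> level_bounded (fun eta => \sum_(i < m) F i eta).
Proof.
elim: m F => [|m IH] F bF.
  rewrite (_ : (fun eta => _) = cst 0); last by apply/funext => eta; rewrite big_ord0.
  by split => // n; exists 0 => s _; rewrite normr0.
rewrite (_ : (fun eta => _) =
  fun eta => F ord0 eta + \sum_(i < m) F (lift ord0 i) eta).
  by apply: level_boundedD => //; apply: IH => i.
by apply/funext => eta; rewrite big_ord_recl.
Qed.

Lemma level_bounded_tensor k (f : k.-tuple E -> R) : bounded_measurable f ->
  level_bounded (fun eta => tensor eta f).
Proof.
move=> bf; split; first exact: measurable_tensor.
have [mf [M fM]] := bf; move=> n.
have M0 : 0 <= `|M| by [].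
exists (`|M| * n%:R ^+ k) => s <-; rewrite tensor_diracs_seq//; apply: powsum_bound => // l lk.
by rewrite tuple_fun_size; apply: le_trans (fM _) (ler_norm _).
Qed.

Lemma level_bounded_lowering F : level_bounded F -> level_bounded (lowering F).
Proof.
move=> [mF bF]; split; first exact: measurable_lowering.
move=> n; have [M FM] := bF n.-1; exists (\sum_(i < n) M) => s sn.
rewrite lowering_diracs_seq// /lower_seq -sn; apply: (le_trans (ler_norm_sum _ _ _)).
by apply: ler_sum => i _; apply: FM; rewrite size_del_at// sn.
Qed.

Lemma level_bounded_iter m F : level_bounded F ->
  level_bounded (iter m (@lowering R d E) F).
Proof. by move=> bF; elim: m => // m; exact: level_bounded_lowering. Qed.

Lemma iter_lowering_diracs_seq m F s :
  iter m (@lowering R d E) F (diracs_seq R s) = iter m (@lower_seq R E) (fun l => F (diracs_seq R l)) s.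
Proof.
elim: m s => // m IH s; rewrite !iterS lowering_diracs_seq//.
by apply: eq_bigr => i _; exact: IH.
Qed.

Definition mass eta : nat := Num.truncn (fine (eta setT)).

Lemma mass_diracs_seq s : mass (diracs_seq R s) = size s.
Proof. by rewrite /mass diracs_seq_size /= natrK. Qed.

(* exp(c A) for the lowering operator A; on a configuration of n points the
   exponential series stops at order n. *)
Definition exp_lowering (c : R) F eta : R :=
  \sum_(m < (mass eta).+1) c ^+ m / m`!%:R * iter m (@lowering R d E) F eta.

Lemma exp_lowering_diracs_seq c F s :
  exp_lowering c F (diracs_seq R s) = exp_lower_seq c (fun l => F (diracs_seq R l)) s.
Proof.
rewrite (exp_lower_seqE c _ (ltnSn (size s))) /exp_lowering mass_diracs_seq.
by apply: eq_bigr => m _; rewrite iter_lowering_diracs_seq.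
Qed.

Lemma level_bounded_exp c F : level_bounded F -> level_bounded (exp_lowering c F).
Proof.
move=> bF; split.
  apply: measurable_nfin_fun => // N.
  rewrite (_ : (fun x => _) = fun x : N.-tuple E =>
      \sum_(m < N.+1) c ^+ m / m`!%:R * iter m (@lowering R d E) F (diracs_seq R x)).
    apply: measurable_sum => m; apply: measurable_funM => //.
    apply: (@measurableT_comp _ _ _ _ _ _ (iter m (@lowering R d E) F)).
      by case: (level_bounded_iter m bF).
    exact: measurable_diracs_seq.
  by apply/funext => x; rewrite diracs_diracs_seq /exp_lowering mass_diracs_seq size_tuple.
have [_ /choice[M FM]] := bF; move=> n; have [B HB] := exp_lower_seq_bound E c n M.
by exists B => s sn; rewrite exp_lowering_diracs_seq; apply: HB => // l; exact: FM.
Qed.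

Definition degree_lt n F : Prop := deg_lt n (fun l => F (diracs_seq R l)).

Lemma degree_ltP n F : degree_lt n F <->
  forall s, (n <= size s)%N -> exp_lowering (-1) F (diracs_seq R s) = 0.
Proof.
split=> [dF s ns|H]; first by rewrite exp_lowering_diracs_seq; exact: exp_lower_seqN_deg_lt ns.
by apply: deg_lt_exp_lower_seqN => s ns; rewrite -exp_lowering_diracs_seq; exact: H.
Qed.

Lemma degree_lt_tensor k (f : k.-tuple E -> R) : bounded_measurable f ->
  degree_lt k.+1 (fun eta => tensor eta f).
Proof.
move=> bf; apply: eq_deg_lt (deg_lt_powsum k (tuple_fun f)) => s.
by rewrite tensor_diracs_seq.
Qed.

Lemma exp_lowering_tensor k (f : k.-tuple E -> R) s : bounded_measurable f ->
  sym_seq (tuple_fun f) -> size s = k ->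
  exp_lowering (-1) (fun eta => tensor eta f) (diracs_seq R s) = k`!%:R * tuple_fun f s.
Proof.
move=> bf sf sk; rewrite exp_lowering_diracs_seq -exp_lower_seqN_powsum//.
by apply: eq_exp_lower_seq => l; rewrite tensor_diracs_seq.
Qed.

Lemma polys_degree n F : polys n F -> level_bounded F /\ degree_lt n.+1 F.
Proof.
move=> [m [c [k [f [fP ->]]]]]; split.
  apply: level_bounded_sum => i; apply: level_boundedZ.
  by apply: level_bounded_tensor; case: (fP i).
apply: deg_lt_bigsum => i; apply: deg_ltZ; have [ki bfi] := fP i.
by apply: (@deg_lt_leq _ _ (k i).+1) => //; exact: degree_lt_tensor.
Qed.

(** The leading term is peeled off: its kernel is read from exp(-A) F on the top level, and
    subtracting it lowers the degree. The kernels are functions on lists, which avoids a family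
    indexed by tuple lengths. *)
Lemma degree_lt_tensors n F : level_bounded F -> degree_lt n F ->
  exists h : nat -> seq E -> R,
    (forall k, bounded_measurable (fun x : k.-tuple E => h k x)) /\
    F = fun eta => \sum_(k < n) tensor eta (fun x : k.-tuple E => h k x).
Proof.
elim: n F => [|n IH] F bF dF.
  exists (fun _ _ => 0); split.
    by move=> k; split => //; exists 0 => x; rewrite normr0.
  by apply: nfin_fun_eq => s; rewrite big_ord0; exact: dF.
pose g := exp_lowering (-1) F.
have bg : level_bounded g by exact: level_bounded_exp.
pose u s : R := g (diracs_seq R s) / n`!%:R.
have bu : bounded_measurable (fun x : n.-tuple E => u x).
  split.
    apply: measurable_funM => //.
    by apply: measurableT_comp; [case: bg|exact: measurable_diracs_seq].
  have [M gM] := bg.2 n; exists (M / n`!%:R) => x; rewrite /u normrM normfV normr_nat.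
  by apply: ler_wpM2r; [rewrite invr_ge0|apply: gM; rewrite size_tuple].
have su : sym_seq (tuple_fun (fun x : n.-tuple E => u x)).
  move=> s s' ss'; have [sn|sn] := eqVneq (size s) n.
    rewrite (tuple_fun_size _ sn) tuple_fun_size; first by rewrite -(perm_size ss').
    by move=> sn'; rewrite /u /= (diracs_seq_perm R ss').
  by rewrite /tuple_fun !insubN// -(perm_size ss').
pose F' eta := F eta - tensor eta (fun x : n.-tuple E => u x).
have bT := level_bounded_tensor bu.
have bF' : level_bounded F'.
  rewrite (_ : F' = fun eta => F eta + (-1) * tensor eta (fun x : n.-tuple E => u x)).
    by apply: level_boundedD => //; exact: level_boundedZ.
  by apply/funext => eta; rewrite mulN1r.
have dF' : degree_lt n F'.
  apply/degree_ltP => s.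
  have -> : exp_lowering (-1) F' (diracs_seq R s) = exp_lowering (-1) F (diracs_seq R s) -
      exp_lowering (-1) (fun eta => tensor eta (fun x : n.-tuple E => u x)) (diracs_seq R s).
    by rewrite !exp_lowering_diracs_seq -exp_lower_seqB.
  (* On n points the difference vanishes by the normalization of [u]; on more points both terms
     vanish by degree. *)
  rewrite leq_eqVlt => /predU1P[sn|sn].
    rewrite exp_lowering_tensor// (tuple_fun_size _ (esym sn)) /u /= mulrCA.
    by rewrite divff ?mulr1 ?subrr// pnatr_eq0 -lt0n fact_gt0.
  have /degree_ltP -> // := dF.
  by have /degree_ltP -> // := degree_lt_tensor bu; rewrite subrr.
have [h [bh Fh]] := IH _ bF' dF'.
exists (fun k => if k == n then u else h k); split.
  by move=> k; case: eqP => [->//|_]; exact: bh.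
apply/funext => eta; rewrite big_ord_recr /= eqxx.
rewrite -[LHS](subrK (tensor eta (fun x : n.-tuple E => u x))); congr (_ + _).
rewrite -/(F' eta) Fh; apply: eq_bigr => k _.
by rewrite (ltn_eqF (ltn_ord k)).
Qed.

Lemma degree_polys n N F : (n <= N.+1)%N -> level_bounded F -> degree_lt n F ->
  polys N F.
Proof.
move=> nN bF dF; have [h [bh ->]] := degree_lt_tensors bF dF.
exists n, (fun=> 1), (fun i => i : nat), (fun i x => h i x); split.
  by move=> i; split; [rewrite -ltnS (leq_trans _ nN)|exact: bh].
by apply/funext => eta; apply: eq_bigr => i _; rewrite mul1r.
Qed.

Lemma polysP n F : polys n F <-> level_bounded F /\ degree_lt n.+1 F.
Proof.
by split=> [|[]]; [exact: polys_degree|exact: degree_polys].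
Qed.

Lemma polys_linear n a F G : polys n F -> polys n G ->
  polys n (fun eta => F eta + a * G eta).
Proof.
move=> /polysP[bF dF] /polysP[bG dG]; apply/polysP; split.
  by apply: level_boundedD => //; exact: level_boundedZ.
by apply: deg_ltD => //; exact: deg_ltZ.
Qed.

Lemma polys0 n : polys n (cst 0 : Nfin R E -> R).
Proof.
by exists 0%N, (fun=> 0), (fun=> 0%N), (fun _ _ => 0); split => [[]//|]; apply/funext => eta; rewrite big_ord0.
Qed.

Lemma symmetric_tuple_fun n (f : n.-tuple E -> R) :
  (forall (s : 'S_n) (x : n.-tuple E), f [tuple tnth x (s i) | i < n] = f x) ->
  sym_seq (tuple_fun f).
Proof.
move=> sf s s' ss'; have [sn|sn] := eqVneq (size s') n; last first.
  by rewrite /tuple_fun !insubN// (perm_size ss').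
have sn' : size s = n by rewrite (perm_size ss').
rewrite (tuple_fun_size _ sn) (tuple_fun_size _ sn').
set x := Tuple _; set y := Tuple _.
have /tuple_permP[p pE] : perm_eq x y by [].
by rewrite -(sf p y); congr f; exact: val_inj.
Qed.

(** The extension is exp(-A) of the tensor power, divided by n!. It equals f on n points and
    vanishes on more, so only finitely many levels enter the bound. *)
Lemma extension_exists n (f : n.-tuple E -> R) : symmetric_bounded f ->
  exists e : Nfin R E -> R, bounded_measurable e /\ forall x, e (diracs R x) = f x.
Proof.
move=> [bf sf]; pose g := exp_lowering (-1) (fun eta => tensor eta f).
have [mg bg] : level_bounded g by apply: level_bounded_exp; exact: level_bounded_tensor.
have g0 s : (n < size s)%N -> g (diracs_seq R s) = 0.
  by move: s; apply/degree_ltP; exact: degree_lt_tensor.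
exists (fun eta => n`!%:R^-1 * g eta); split; last first.
  move=> x; rewrite diracs_diracs_seq /g exp_lowering_tensor ?size_tuple//; last exact: symmetric_tuple_fun.
  by rewrite tuple_fun_tuple mulrA mulVf ?mul1r// pnatr_eq0 -lt0n fact_gt0.
split; first exact: measurable_funM.
have [M gM] := choice bg.
exists (n`!%:R^-1 * \sum_(k < n.+1) `|M k|) => eta; have [s ->] := nfin_diracs_seq hE eta.
rewrite normrM normfV normr_nat ler_wpM2l ?invr_ge0//.
have [sn|sn] := ltnP n (size s); first by rewrite g0// normr0 sumr_ge0.
apply: (le_trans (gM _ _ erefl)); apply: (le_trans (ler_norm _)).
by rewrite (bigD1 (Ordinal (sn : (size s < n.+1)%N)))//= lerDl sumr_ge0.
Qed.

End level_bounded.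

(** * The semigroup on polynomials *)

Section semigroup_polys.
Context (R : realType) d (E : measurableType d) d' (Om : measurableType d').
Variables (X : R -> Om -> Nfin R E) (P : Nfin R E -> probability Om R).
Hypotheses (hE : borel_space R E) (hX : is_markov_process X P)
  (hcons : consistent X P) (hconserv : conservative X P).
Variable t : R.
Hypothesis t0 : 0 <= t.
Implicit Types (F G : Nfin R E -> R) (eta : Nfin R E) (s : seq E).
Local Notation Pt := (semigroup X P t).

Let mX : measurable_fun setT (X t).
Proof. exact: (markov_measurable hX). Qed.

Definition transition eta : {measure set Nfin R E -> \bar R}.
Proof. refine (pushforward (P eta) (X t)); exact: mX. Defined.

Lemma measurable_transition B : measurable B ->
  measurable_fun setT (fun eta => transition eta B).
Proof. exact: (markov_kernel hX t0). Qed.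

Lemma ge0_integral_transition eta (f : Nfin R E -> \bar R) :
  (forall x, 0 <= f x)%E -> measurable_fun setT f ->
  (\int[transition eta]_x f x = \int[P eta]_w f (X t w))%E.
Proof.
by move=> f0 mf; rewrite ge0_integral_pushforward// preimage_setT.
Qed.

Lemma measurable_ge0_semigroup (f : Nfin R E -> \bar R) :
  (forall x, 0 <= f x)%E -> measurable_fun setT f ->
  measurable_fun setT (fun eta => \int[P eta]_w f (X t w))%E.
Proof.
move=> f0 mf; under eq_fun do rewrite -ge0_integral_transition//.
by apply: measurable_fun_integral_kernel => //; exact: measurable_transition.
Qed.

Lemma measurable_semigroup F : measurable_fun setT F -> measurable_fun setT (Pt F).
Proof.
move=> mF; rewrite /semigroup /Rintegral.
apply: (measurableT_comp (fine_measurable measurableT)).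
have mEF : measurable_fun setT (EFin \o F) by exact/measurable_EFinP.
under eq_fun do rewrite integralE.
apply: emeasurable_funB.
- have h := measurable_ge0_semigroup (funepos_ge0 (EFin \o F)) (measurable_funepos mEF).
  by apply: eq_measurable_fun h => eta _; apply: eq_integral => w _; rewrite !funeposE.
- have h := measurable_ge0_semigroup (funeneg_ge0 (EFin \o F)) (measurable_funeneg mEF).
  by apply: eq_measurable_fun h => eta _; apply: eq_integral => w _; rewrite !funenegE.
Qed.

Lemma mass_ae eta : {ae P eta, forall w, mass (X t w) = mass eta}.
Proof.
apply: filterS2 (hconserv eta) (markov_init hX eta) => w /(_ t t0) Xt X0.
by rewrite /mass Xt X0.
Qed.

Lemma measurable_semigroup_comp F : measurable_fun setT F ->
  measurable_fun setT (fun w => (F (X t w))%:E).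
Proof. by move=> mF; apply/measurable_EFinP; exact: measurableT_comp mF mX. Qed.

(** By conservativity P_t F at eta only sees F on the level of eta. *)
Lemma eq_semigroup F G eta : measurable_fun setT F -> measurable_fun setT G ->
  (forall xi, mass xi = mass eta -> F xi = G xi) -> Pt F eta = Pt G eta.
Proof.
move=> mF mG FG; rewrite /semigroup /Rintegral; congr fine.
apply: ae_eq_integral => //; [exact: measurable_semigroup_comp..|].
by apply: filterS (mass_ae eta) => w Xw _ /=; rewrite FG.
Qed.

(** Makes a level-bounded function bounded, so that consistency applies to it. *)
Definition cut N F eta : R := if (mass eta <= N)%N then F eta else 0.

Lemma bounded_measurable_cut N F : level_bounded F -> bounded_measurable (cut N F).
Proof.
move=> [mF bF]; split.
  apply: measurable_nfin_fun => // n.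
  rewrite (_ : (fun x => _) = fun x : n.-tuple E =>
    if (n <= N)%N then F (diracs R x) else 0); last first.
    by apply/funext => x; rewrite /cut diracs_diracs_seq mass_diracs_seq size_tuple.
  case: (n <= N)%N => //.
  by apply: (measurableT_comp mF); exact: measurable_diracs.
have [M FM] := choice bF.
exists (\sum_(k < N.+1) `|M k|) => eta; have [s ->] := nfin_diracs_seq hE eta.
rewrite /cut mass_diracs_seq; case: ifPn => sN; last by rewrite normr0 sumr_ge0.
apply: (le_trans (FM _ _ erefl)); apply: (le_trans (ler_norm _)).
by rewrite (bigD1 (Ordinal (sN : (size s < N.+1)%N)))//= lerDl sumr_ge0.
Qed.

Lemma semigroup_cut N F eta : level_bounded F -> (mass eta <= N)%N ->
  Pt (cut N F) eta = Pt F eta.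
Proof.
move=> bF eN; apply: eq_semigroup => [||xi e]; last by rewrite /cut e eN.
  by have [] := bounded_measurable_cut N bF.
by case: bF.
Qed.

Lemma semigroup_integrable F eta : level_bounded F ->
  (P eta).-integrable setT (fun w => (F (X t w))%:E).
Proof.
move=> bF; have [mF _] := bF; have [mc [M cM]] := bounded_measurable_cut (mass eta) bF.
apply/integrableP; split; first exact: measurable_semigroup_comp.
rewrite (@ge0_ae_eq_integral _ _ _ _ _ _
  (fun w => `|(cut (mass eta) F (X t w))%:E|)%E)//; last 3 first.
- by apply: measurableT_comp => //; exact: measurable_semigroup_comp.
- by apply: measurableT_comp => //; exact: measurable_semigroup_comp.
- by apply: filterS (mass_ae eta) => w Xw _ /=; rewrite /cut Xw leqnn.
have : (P eta).-integrable setT (EFin \o (cut (mass eta) F \o X t)).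
  apply: bounded_measurable_integrable.
    by rewrite -ge0_fin_numE//; exact: fin_num_measure.
  by split; [exact: measurableT_comp|exists M => w; exact: cM].
by case/integrableP.
Qed.

Lemma semigroup_bound F eta M : level_bounded F ->
  (forall xi, mass xi = mass eta -> `|F xi| <= M) -> `|Pt F eta| <= M.
Proof.
move=> bF FM; rewrite /semigroup.
apply: (le_trans (le_normr_Rintegral _ _)) => //; first exact: semigroup_integrable.
have iF := semigroup_integrable eta bF.
rewrite -lee_fin /Rintegral fineK; last first.
  by apply: integrable_fin_num => //; exact: integrable_norm.
apply: (@le_trans _ _ (\int[P eta]_w M%:E)%E); last first.
  rewrite integral_cst// (_ : (P eta : {measure set Om -> \bar R}) setT = 1%E) ?mule1//.
  exact: probability_setT.
apply: ae_ge0_le_integral => //.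
- apply/measurable_EFinP; apply: measurableT_comp => //.
  by apply: measurableT_comp mX; case: bF.
- by move=> w _; rewrite lee_fin; exact: le_trans (FM eta erefl).
- by apply: filterS (mass_ae eta) => w Xw _; rewrite lee_fin FM.
Qed.

Lemma level_bounded_semigroup F : level_bounded F -> level_bounded (Pt F).
Proof.
move=> bF; split; first by apply: measurable_semigroup; case: bF.
move=> n; have [_ /(_ n)[M FM]] := bF; exists M => s sn.
apply: semigroup_bound => // xi; have [s' ->] := nfin_diracs_seq hE xi.
by rewrite !mass_diracs_seq sn; exact: FM.
Qed.

Lemma semigroupD F G eta : level_bounded F -> level_bounded G ->
  Pt (fun xi => F xi + G xi) eta = Pt F eta + Pt G eta.
Proof.
by move=> bF bG; rewrite /semigroup RintegralD//; exact: semigroup_integrable.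
Qed.

Lemma semigroupZ a F eta : level_bounded F ->
  Pt (fun xi => a * F xi) eta = a * Pt F eta.
Proof.
by move=> bF; rewrite /semigroup RintegralZl//; exact: semigroup_integrable.
Qed.

Lemma semigroup0 eta : Pt (cst 0) eta = 0.
Proof. by rewrite /semigroup Rintegral_cst// mul0r. Qed.

Lemma semigroup_sum m (F : 'I_m -> Nfin R E -> R) eta :
  (forall i, level_bounded (F i)) ->
  Pt (fun xi => \sum_(i < m) F i xi) eta = \sum_(i < m) Pt (F i) eta.
Proof.
elim: m F => [|m IH] F bF.
  rewrite big_ord0 -[RHS](semigroup0 eta); congr (semigroup X P t _ eta).
  by apply/funext => xi; rewrite big_ord0.
rewrite big_ord_recl -IH//.
rewrite -semigroupD//; last by apply: level_bounded_sum => i.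
congr (semigroup X P t _ eta).
by apply/funext => xi; rewrite big_ord_recl.
Qed.

(** At s both sides involve F only on configurations with one point fewer, where F and its cut at
    [size s] agree. *)
Lemma semigroup_lowering F : level_bounded F ->
  Pt (lowering F) = lowering (Pt F).
Proof.
move=> bF; apply: (nfin_fun_eq hE) => s.
have bc := bounded_measurable_cut (size s) bF.
transitivity (Pt (lowering (cut (size s) F)) (diracs_seq R s)).
  apply: eq_semigroup; [by apply: measurable_lowering => //; case: bF|
    by apply: measurable_lowering => //; case: bc|].
  move=> xi; have [s' ->] := nfin_diracs_seq hE xi; rewrite !mass_diracs_seq => ss'.
  rewrite !lowering_diracs_seq//; apply: eq_bigr => i _.
  by rewrite /cut mass_diracs_seq size_del_at// -ss' leq_pred.
rewrite hcons// !lowering_diracs_seq//; apply: eq_bigr => i _.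
by rewrite semigroup_cut// mass_diracs_seq size_del_at// leq_pred.
Qed.

Lemma semigroup_iter_lowering m F : level_bounded F ->
  Pt (iter m (@lowering R d E) F) = iter m (@lowering R d E) (Pt F).
Proof.
move=> bF; elim: m => // m IH; rewrite !iterS semigroup_lowering ?IH//.
exact: level_bounded_iter.
Qed.

Lemma semigroup_exp_lowering c F : level_bounded F ->
  Pt (exp_lowering c F) = exp_lowering c (Pt F).
Proof.
move=> bF; apply: (nfin_fun_eq hE) => s; rewrite [RHS]/exp_lowering mass_diracs_seq.
(* The number of terms of [exp_lowering] varies with the configuration; it is frozen on the level of
   s before P_t is moved inside the sum. *)
transitivity (Pt (fun xi => \sum_(m < (size s).+1)
    c ^+ m / m`!%:R * iter m (@lowering R d E) F xi) (diracs_seq R s)).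
  have b1 := level_bounded_exp hE c bF.
  apply: eq_semigroup; [by case: b1| |].
    apply: measurable_sum => m; apply: measurable_funM => //.
    by case: (level_bounded_iter hE m bF).
  by move=> xi; rewrite mass_diracs_seq /exp_lowering => ->.
rewrite semigroup_sum; last first.
  by move=> i; apply: level_boundedZ => //; exact: level_bounded_iter.
apply: eq_bigr => i _; rewrite semigroupZ; last exact: level_bounded_iter.
by rewrite semigroup_iter_lowering.
Qed.

(** exp(-A) P_t F = P_t exp(-A) F, and the function exp(-A) F is zero on the whole level of s. *)
Lemma semigroup_degree n F : level_bounded F -> degree_lt n F -> degree_lt n (Pt F).
Proof.
move=> bF /(degree_ltP hE) dF; apply/(degree_ltP hE) => s ns.
rewrite -semigroup_exp_lowering// -[RHS](semigroup0 (diracs_seq R s)).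
apply: eq_semigroup => [||xi]; [by case: (level_bounded_exp hE (-1) bF)| |].
  exact: measurable_cst.
by have [s' ->] := nfin_diracs_seq hE xi; rewrite !mass_diracs_seq => ss'; rewrite dF// ss'.
Qed.

Lemma semigroup_polys n F : polys n F -> polys n (Pt F).
Proof.
move=> /(polysP hE)[bF dF]; apply/(polysP hE); split.
  exact: level_bounded_semigroup.
exact: semigroup_degree.
Qed.

Lemma bounded_measurable_level_bounded F : bounded_measurable F -> level_bounded F.
Proof. by move=> [mF [M FM]]; split => // n; exists M. Qed.

Lemma extensionP n (f : n.-tuple E -> R) : symmetric_bounded f ->
  bounded_measurable (extension f) /\ forall x, extension f (diracs R x) = f x.
Proof.
move=> /(extension_exists hE) ex.
exact: (@getPex _ [set e : Nfin R E -> R |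
  bounded_measurable e /\ forall x, e (diracs R x) = f x]).
Qed.

Lemma npart_tuple_fun n (f : n.-tuple E -> R) s : size s = n ->
  tuple_fun (npart_semigroup X P t f) s = Pt (extension f) (diracs_seq R s).
Proof. by move=> sn; rewrite (tuple_fun_size _ sn) /npart_semigroup diracs_diracs_seq. Qed.

Lemma bounded_measurable_npart n (f : n.-tuple E -> R) : symmetric_bounded f ->
  bounded_measurable (npart_semigroup X P t f).
Proof.
move=> /extensionP[/bounded_measurable_level_bounded be _].
have [me bb] := level_bounded_semigroup be; split.
  by apply: (measurableT_comp me); exact: measurable_diracs.
have [M eM] := bb n; exists M => x; rewrite /npart_semigroup diracs_diracs_seq.
by apply: eM; rewrite size_tuple.
Qed.

Lemma sym_npart n (f : n.-tuple E -> R) :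
  sym_seq (tuple_fun (npart_semigroup X P t f)).
Proof.
move=> s s' ss'; have [sn|sn] := eqVneq (size s) n.
  by rewrite !npart_tuple_fun -?(perm_size ss')// (diracs_seq_perm R ss').
by rewrite /tuple_fun !insubN// -(perm_size ss').
Qed.

Lemma semigroup_tensor n (f : n.-tuple E -> R) : (0 < n)%N -> symmetric_bounded f ->
  polys n.-1 (fun eta => Pt (fun xi => tensor xi f) eta -
                         tensor eta (npart_semigroup X P t f)).
Proof.
case: n f => // n f _ sf; have [bf sf'] := sf.
have bp := bounded_measurable_npart sf; have [be ef] := extensionP sf.
have bT := level_bounded_tensor hE bf; have bp' := level_bounded_tensor hE bp.
have bPT := level_bounded_semigroup bT.
apply: (degree_polys hE (leqnn _)).
  rewrite (_ : (fun eta => _) = fun eta => Pt (fun xi => tensor xi f) eta +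
    (-1) * tensor eta (npart_semigroup X P t f)).
    by apply: level_boundedD => //; exact: level_boundedZ.
  by apply/funext => eta; rewrite mulN1r.
apply/(degree_ltP hE) => s.
have -> : forall A B, exp_lowering (-1) (fun eta => A eta - B eta) (diracs_seq R s) =
    exp_lowering (-1) A (diracs_seq R s) - exp_lowering (-1) B (diracs_seq R s).
  by move=> A B; rewrite !exp_lowering_diracs_seq// -exp_lower_seqB.
rewrite -/(Pt _) leq_eqVlt => /predU1P[sn|sn]; last first.
  have /(degree_ltP hE) -> // := semigroup_degree bT (degree_lt_tensor bf).
  by have /(degree_ltP hE) -> // := degree_lt_tensor bp; rewrite subrr.
rewrite (exp_lowering_tensor hE bp (@sym_npart _ f) (esym sn)).
(* On the top level both terms are P_t of functions, exp(-A) of the tensor power of f and n! times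
   the extension of f, which coincide on that level. *)
rewrite npart_tuple_fun// -semigroup_exp_lowering//.
rewrite -semigroupZ; last exact: bounded_measurable_level_bounded.
apply/eqP; rewrite subr_eq0; apply/eqP; apply: eq_semigroup.
- by case: (level_bounded_exp hE (-1) bT).
- by apply: measurable_funM => //; case: be.
move=> xi; have [s' ->] := nfin_diracs_seq hE xi; rewrite !mass_diracs_seq => ss'.
have s'n : size s' = n.+1 by rewrite ss'.
rewrite (exp_lowering_tensor hE bf (symmetric_tuple_fun sf') s'n).
by rewrite (tuple_fun_size _ s'n) -ef diracs_diracs_seq.
Qed.

End semigroup_polys.

(** * Reversible kernels on L^2 *)

Section average.
Context (R : realType) d (T : measurableType d) d' (T' : measurableType d')
  (rho : probability T R) (kap : T -> {measure set T' -> \bar R}).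
Hypotheses (mk : forall U, measurable U -> measurable_fun setT (kap ^~ U))
  (k1 : forall x, (kap x setT = 1)%E).

Definition cst_kernel (_ : unit) : {measure set T -> \bar R} := rho.

HB.instance Definition _ := isKernel.Build _ _ _ _ _ cst_kernel
  (fun U mU => measurable_cst (rho U)).
HB.instance Definition _ := Kernel_isProbability.Build _ _ _ _ _ cst_kernel
  (fun=> probability_setT rho).

Definition snd_kernel (p : unit * T) : {measure set T' -> \bar R} := kap p.2.

HB.instance Definition _ := isKernel.Build _ _ _ _ _ snd_kernel
  (fun U mU => measurableT_comp (mk mU) measurable_snd).
HB.instance Definition _ := Kernel_isProbability.Build _ _ _ _ _ snd_kernel
  (fun p => k1 p.2).

(** The iterated integral is the integral against a composition of two kernels started at the single
    point of [unit], and this composition agrees with [nu] on measurable sets. *)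
Lemma integral_average (nu : {measure set T' -> \bar R}) :
  (forall B, measurable B -> (\int[rho]_x kap x B = nu B)%E) ->
  forall f : T' -> \bar R, (forall x, 0 <= f x)%E -> measurable_fun setT f ->
  (\int[rho]_x \int[kap x]_y f y = \int[nu]_y f y)%E.
Proof.
move=> knu f f0 mf.
have := @integral_kcomp _ _ _ _ _ _ _ cst_kernel snd_kernel tt f f0 mf.
move=> <-; apply: eq_measure_integral => A mA _.
exact: knu.
Qed.

End average.

Section clamp.
Context (R : realType).

Definition clamp (n : nat) (y : R) : R := Num.max (- n%:R) (Num.min n%:R y).

Lemma clamp_id n y : `|y| <= n%:R -> clamp n y = y.
Proof. by rewrite ler_norml /clamp => /andP[h1 /min_idPr ->]; apply/max_idPr. Qed.

Lemma clamp_le n y : `|clamp n y| <= n%:R.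
Proof.
have n0 : (0 : R) <= n%:R by [].
rewrite /clamp ler_norml le_max lexx/= ge_max ge_min lexx/= andbT.
by apply: le_trans n0; rewrite oppr_le0.
Qed.

Lemma clamp_norm n y : `|clamp n y| <= `|y|.
Proof.
have n0 : (0 : R) <= n%:R by [].
have [yn|/ltW yn] := leP `|y| n%:R; first by rewrite clamp_id.
exact: le_trans (clamp_le n y) yn.
Qed.

Lemma cvg_clamp y : clamp n y @[n --> \oo] --> y.
Proof.
apply: cvg_near_cst; exists (Num.truncn `|y|).+1 => // n /= yn.
apply/clamp_id/ltW; apply: lt_le_trans (truncnS_gt _) _.
by rewrite ler_nat.
Qed.

Lemma measurable_clamp n : measurable_fun setT (clamp n).
Proof. by apply: measurable_maxr => //; exact: measurable_minr. Qed.

Lemma bounded_measurable_clamp d (T : measurableType d) n (f : T -> R) :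
  measurable_fun setT f -> bounded_measurable (fun x => clamp n (f x)).
Proof.
move=> mf; split; first exact: measurableT_comp (measurable_clamp n) mf.
by exists n%:R => x; exact: clamp_le.
Qed.

End clamp.

(** * Extension of reversibility from bounded functions to L^2 *)

Section reversible_kernel.
Context (R : realType) d (T : measurableType d) (rho : probability T R)
  (kap : T -> {measure set T -> \bar R}).
Hypotheses (mk : forall U, measurable U -> measurable_fun setT (kap ^~ U))
  (k1 : forall x, (kap x setT = 1)%E).
Implicit Types f g : T -> R.

Definition kernel_op f x : R := \int[kap x]_y f y.

Hypothesis krev : forall f g, bounded_measurable f -> bounded_measurable g ->
  L2_inner rho f (kernel_op g) = L2_inner rho g (kernel_op f).

Let k_fin x U : measurable U -> kap x U \is a fin_num.
Proof.
move=> mU; rewrite ge0_fin_numE//; apply: (@le_lt_trans _ _ (kap x setT)).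
  by apply: le_measure; rewrite ?inE.
by rewrite k1 ltry.
Qed.

(** Reversibility tested on the constant 1 and the indicator of B. *)
Lemma reversible_invariant B : measurable B -> (\int[rho]_x kap x B = rho B)%E.
Proof.
move=> mB.
have b1 : bounded_measurable (cst 1 : T -> R) by split => //; exists 1 => x; rewrite normr1.
have bB : bounded_measurable (\1_B : T -> R).
  by split => //; exists 1 => x; rewrite indicE; case: (_ \in _); rewrite ?normr1 ?normr0.
have kB x : kernel_op \1_B x = fine (kap x B).
  by rewrite /kernel_op /Rintegral integral_indic// setIT.
have k1E x : kernel_op (cst 1) x = 1 by rewrite /kernel_op Rintegral_cst// k1 /= mul1r.
have := krev b1 bB; rewrite /L2_inner /Rintegral.
under eq_integral do rewrite kB mul1r fineK ?k_fin//.
under [in X in _ = X -> _]eq_integral do rewrite k1E mulr1.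
rewrite integral_indic// setIT => h.
rewrite -[LHS]fineK ?h ?fineK//; first exact: fin_num_measure.
rewrite ge0_fin_numE; last exact: integral_ge0.
apply: (@le_lt_trans _ _ (\int[rho]_x 1)%E).
  apply: ge0_le_integral => //; first exact: mk.
  by move=> x _; rewrite -(k1 x); apply: le_measure; rewrite ?inE.
by rewrite integral_cst// mul1e -ge0_fin_numE// fin_num_measure.
Qed.

Lemma integral_kernel_op (f : T -> \bar R) : (forall x, 0 <= f x)%E ->
  measurable_fun setT f -> (\int[rho]_x \int[kap x]_y f y = \int[rho]_y f y)%E.
Proof. exact: (integral_average mk k1 reversible_invariant). Qed.

Lemma measurable_integral_kap (f : T -> \bar R) : (forall x, 0 <= f x)%E ->
  measurable_fun setT f -> measurable_fun setT (fun x => \int[kap x]_y f y)%E.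
Proof. by move=> f0 mf; exact: measurable_fun_integral_kernel. Qed.

Lemma measurable_kernel_op f : measurable_fun setT f -> measurable_fun setT (kernel_op f).
Proof.
move=> mf; apply: (measurableT_comp (fine_measurable measurableT)).
have mEf : measurable_fun setT (EFin \o f) by exact/measurable_EFinP.
under eq_fun do rewrite integralE.
by apply: emeasurable_funB; apply: measurable_integral_kap => //;
  [exact: measurable_funepos|exact: measurable_funeneg].
Qed.

Lemma L2_norm (mu : {measure set T -> \bar R}) f : L2 mu f -> L2 mu (fun x => `|f x|).
Proof.
move=> /L2P[mf if2]; apply/L2P; split; first exact: measurableT_comp.
by move: if2; under [X in _ -> _.-integrable _ X]eq_fun do rewrite real_normK ?num_real//.
Qed.

Lemma sqr_integrableP (mu : {measure set T -> \bar R}) f : measurable_fun setT f ->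
  mu.-integrable setT (EFin \o (fun x => f x ^+ 2)) <->
  (\int[mu]_x (f x ^+ 2)%:E < +oo)%E.
Proof.
move=> mf; have E : (\int[mu]_x (f x ^+ 2)%:E =
    \int[mu]_x `|(EFin \o (fun x => (f x ^+ 2)%R)) x|)%E.
  by apply: eq_integral => x _ /=; rewrite ger0_norm ?sqr_ge0.
rewrite E; split => [/integrableP[]//|h]; apply/integrableP; split => //.
by apply/measurable_EFinP; exact: measurable_funX.
Qed.

(** By invariance the integral of f^2 against [kap x] has a finite rho-integral, so it is finite for
    almost every x. *)
Lemma L2_kap_ae f : L2 rho f -> {ae rho, forall x, L2 (kap x) f}.
Proof.
move=> /L2P[mf if2].
have mf2 : measurable_fun setT (fun y => (f y ^+ 2)%:E).
  by apply/measurable_EFinP; exact: measurable_funX.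
have f20 y : (0 <= (f y ^+ 2)%:E)%E by rewrite lee_fin sqr_ge0.
have : rho.-integrable setT (fun x => \int[kap x]_y (f y ^+ 2)%:E)%E.
  apply/integrableP; split; first exact: measurable_integral_kap.
  under eq_integral do rewrite gee0_abs ?integral_ge0//.
  by rewrite integral_kernel_op//; exact/sqr_integrableP.
move/(integrable_ae measurableT); apply: filterS => x /(_ Logic.I) fx.
apply/L2P; split => //; apply/sqr_integrableP => //.
by rewrite -ge0_fin_numE// integral_ge0.
Qed.

Let L2_cst1 x : L2 (kap x) (cst 1).
Proof.
apply/L2P; split => //; apply/sqr_integrableP => //.
under eq_integral do rewrite /= expr1n.
by rewrite integral_cst// k1 mule1 ltry.
Qed.

Let L2_kap_integrable x f : L2 (kap x) f -> (kap x).-integrable setT (EFin \o f).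
Proof.
move=> Lf; have := L2_mul Lf (L2_cst1 x).
by under [X in _.-integrable _ X -> _]eq_fun do rewrite mulr1.
Qed.

(** Jensen's inequality, as Cauchy-Schwarz against the constant 1. *)
Lemma kernel_op_sqr_le x f : L2 (kap x) f -> kernel_op f x ^+ 2 <= L2_inner (kap x) f f.
Proof.
move=> Lf; have := L2_cauchy_schwarz Lf (L2_cst1 x).
have -> : L2_inner (kap x) f (cst 1) = kernel_op f x.
  by apply: eq_Rintegral => y _; rewrite mulr1.
suff -> : L2_inner (kap x) (cst 1) (cst 1) = 1 by rewrite mulr1.
transitivity (\int[kap x]_y (1 : R)).
  by apply: eq_Rintegral => y _; rewrite mulr1.
by rewrite Rintegral_cst// k1 /= mulr1.
Qed.

Lemma L2_kernel_op f : L2 rho f -> L2 rho (kernel_op f).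
Proof.
move=> Lf; have [mf if2] := (L2P _ _).1 Lf.
have mkf := measurable_kernel_op mf.
have mf2 : measurable_fun setT (fun y => (f y ^+ 2)%:E).
  by apply/measurable_EFinP; exact: measurable_funX.
have f20 y : (0 <= (f y ^+ 2)%:E)%E by rewrite lee_fin sqr_ge0.
apply/L2P; split => //; apply/integrableP; split.
  by apply/measurable_EFinP; exact: measurable_funX.
apply: (@le_lt_trans _ _ (\int[rho]_x \int[kap x]_y (f y ^+ 2)%:E)%E).
  apply: ae_ge0_le_integral => //.
  - by apply: measurableT_comp => //; apply/measurable_EFinP; exact: measurable_funX.
  - by move=> x _; exact: integral_ge0.
  - exact: measurable_integral_kap.
  - apply: filterS (L2_kap_ae Lf) => x Lx _ /=.
    rewrite ger0_norm ?sqr_ge0//= L2_innerE// lee_fin; exact: kernel_op_sqr_le.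
by rewrite integral_kernel_op//; exact/sqr_integrableP.
Qed.

Lemma cvg_kernel_op_clamp g x : L2 (kap x) g ->
  kernel_op (fun y => clamp n (g y)) x @[n --> \oo] --> kernel_op g x.
Proof.
move=> Lg; have mg := L2_measurable Lg.
have [] := @dominated_convergence _ _ _ (kap x) setT measurableT
  (fun n y => (clamp n (g y))%:E) (EFin \o g) (fun y => `|g y|%:E).
- move=> n; apply/measurable_EFinP; exact: measurableT_comp (measurable_clamp n) mg.
- exact/measurable_EFinP.
- apply: aeW => y _; apply: cvg_EFin; [exact: nearW|exact: cvg_clamp].
- by have := integrable_norm (L2_kap_integrable Lg).
- by apply: aeW => y n _; rewrite /= lee_fin clamp_norm.
by move=> ig _; rewrite -(fineK (integrable_fin_num measurableT ig)) => /fine_cvg.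
Qed.

Lemma kernel_op_clamp_le g x n : L2 (kap x) g ->
  `|kernel_op (fun y => clamp n (g y)) x| <= kernel_op (fun y => `|g y|) x.
Proof.
move=> Lg; have mg := L2_measurable Lg.
have kf : (kap x setT < +oo)%E by rewrite k1 ltry.
have ic := bounded_measurable_integrable kf (bounded_measurable_clamp n mg).
apply: (le_trans (le_normr_Rintegral _ _)) => //.
apply: le_Rintegral => //; [exact: (integrable_norm ic)|
  exact: (integrable_norm (L2_kap_integrable Lg))|].
by move=> y _; exact: clamp_norm.
Qed.

(** Dominated convergence with the bound |f| times the kernel operator applied to |g|, a product of
    two functions of L^2(rho). *)
Lemma cvg_inner_clamp f g : L2 rho f -> L2 rho g ->
  L2_inner rho (fun x => clamp n (f x)) (kernel_op (fun y => clamp n (g y)))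
    @[n --> \oo] --> L2_inner rho f (kernel_op g).
Proof.
move=> Lf Lg; have mf := L2_measurable Lf; have mg := L2_measurable Lg.
have Lng := L2_norm Lg; have Lnf := L2_norm Lf.
have [] := @dominated_convergence _ _ _ rho setT measurableT
  (fun n x => (clamp n (f x) * kernel_op (fun y => clamp n (g y)) x)%:E)
  (fun x => (f x * kernel_op g x)%:E) (fun x => (`|f x| * kernel_op (fun y => `|g y|) x)%:E).
- move=> n; apply/measurable_EFinP; apply: measurable_funM.
    exact: measurableT_comp (measurable_clamp n) mf.
  by apply: measurable_kernel_op; exact: measurableT_comp (measurable_clamp n) mg.
- by apply/measurable_EFinP; apply: measurable_funM => //; exact: measurable_kernel_op.
- apply: filterS (L2_kap_ae Lg) => x Lx _; apply: cvg_EFin; first exact: nearW.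
  by apply: cvgM; [exact: cvg_clamp|exact: cvg_kernel_op_clamp].
- exact: L2_mul Lnf (L2_kernel_op Lng).
- apply: filterS (L2_kap_ae Lg) => x Lx n _; rewrite /= lee_fin normrM.
  by apply: ler_pM => //; [exact: clamp_norm|exact: kernel_op_clamp_le].
by move=> ig _; rewrite -(fineK (integrable_fin_num measurableT ig)) => /fine_cvg.
Qed.

Lemma kernel_op_sym f g : L2 rho f -> L2 rho g ->
  L2_inner rho f (kernel_op g) = L2_inner rho g (kernel_op f).
Proof.
move=> Lf Lg; have c1 := cvg_inner_clamp Lf Lg; have c2 := cvg_inner_clamp Lg Lf.
suff E : (fun n => L2_inner rho (fun x => clamp n (f x)) (kernel_op (fun y => clamp n (g y)))) =
    (fun n => L2_inner rho (fun x => clamp n (g x)) (kernel_op (fun y => clamp n (f y)))).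
  by rewrite E in c1; exact: cvg_unique c1 c2.
apply/funext => n; apply: krev; apply: bounded_measurable_clamp;
  [exact: L2_measurable Lf|exact: L2_measurable Lg].
Qed.

End reversible_kernel.

(** * Intertwining *)

Section projection_unique.
Context (R : realType) d (T : measurableType d) (rho : probability T R).
Variable S : set (T -> R).
Hypotheses (SL : S `<=` L2 rho) (S0 : S (cst 0))
  (SDZ : forall a f g, S f -> S g -> S (fun x => f x + a * g x)).
Local Notation K := (L2_orth rho (L2_closure rho S)).

Lemma L2_proj_orthP F : L2 rho F -> is_L2_proj rho K F (L2_proj rho K F).
Proof.
move=> LF; have [q [Lq cq] oq] := L2_proj_exists SL S0 SDZ LF.
apply: (@getPex _ (is_L2_proj rho K F)); exists (fun x => F x - q x).
split; first by rewrite L2_orth_closure.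
(* The residual is q itself, which lies in the closure of S and so is orthogonal to K by the
   definition of K. *)
rewrite (_ : (fun x => _) \- _ = q); last first.
  by apply/funext => x /=; rewrite opprB addrC subrK.
split => // k [Lk /(_ q)]; rewrite L2_innerC; apply; split => //.
Qed.

(** The difference of two candidates lies in K and is also a difference of residuals, hence
    orthogonal to itself. *)
Lemma L2_proj_orth_unique F h1 h2 : is_L2_proj rho K F h1 -> is_L2_proj rho K F h2 ->
  {ae rho, forall x, h1 x = h2 x}.
Proof.
move=> [[L1 o1] [LF1 p1]] [[L2' o2] [LF2 p2]].
pose u x := h1 x - h2 x.
have Lu : L2 rho u by exact: L2B.
have Ku : K u.
  split => // g cg; have Lg : L2 rho g by case: cg.
  by rewrite L2_innerBl// o1// o2// subrr.
suff : L2_inner rho u u = 0.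
  move/(L2_inner_eq0 Lu); apply: filterS => x /eqP.
  by rewrite subr_eq0 => /eqP.
have -> : L2_inner rho u u = L2_inner rho (fun x => (F x - h2 x) - (F x - h1 x)) u.
  by apply: eq_Rintegral => x _; rewrite /u; congr (_ * _); ring.
by rewrite L2_innerBl// (p1 u)// (p2 u)// subrr.
Qed.

End projection_unique.

Section orthogonal_polynomials_intertwining.
Context (R : realType) d (E : measurableType d) d' (Om : measurableType d').
Variables (X : R -> Om -> Nfin R E) (P : Nfin R E -> probability Om R).
Variable rho : probability (Nfin R E) R.
Hypotheses (hE : borel_space R E) (hX : is_markov_process X P)
  (hcons : consistent X P) (hconserv : conservative X P)
  (hrev : reversible X P rho)
  (hmom : forall n : nat, (0 < n)%N -> (\int[rho]_eta (eta setT ^+ n) < +oo)%E).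
Variable t : R.
Hypothesis t0 : 0 <= t.
Local Notation Pt := (semigroup X P t).

Lemma measurable_mass_exp n :
  measurable_fun setT (fun eta : Nfin R E => eta setT ^+ n)%E.
Proof.
elim: n => [|n IH]; first exact: measurable_cst.
have mS := emeasurable_funM (measurable_eval (R := R) (@measurableT _ E)) IH.
by apply: eq_measurable_fun mS => eta _; exact/esym/expeS.
Qed.

Lemma L2_tensor k (f : k.-tuple E -> R) : bounded_measurable f ->
  L2 rho (fun eta => tensor eta f).
Proof.
move=> bf; have [mf [M fM]] := bf; have mT := measurable_tensor hE bf.
apply/L2P; split => //; apply/sqr_integrableP => //.
apply: (@le_lt_trans _ _ (\int[rho]_eta ((`|M| ^+ 2)%:E * eta setT ^+ (k * 2)))%E).
  have mE : measurable_fun setT (fun eta : Nfin R E => eta setT ^+ (k * 2))%E.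
    exact: measurable_mass_exp.
  apply: ge0_le_integral => //.
  - by move=> eta _; rewrite lee_fin sqr_ge0.
  - by apply/measurable_EFinP; exact: measurable_funX.
  - exact: measurable_funeM.
  - move=> eta _; have [s ->] := nfin_diracs_seq hE eta.
    rewrite diracs_seq_size -EFin_expe -EFinM lee_fin tensor_diracs_seq// exprM -exprMn.
    rewrite -real_normK ?num_real// lerXn2r ?nnegrE ?mulr_ge0 ?exprn_ge0//.
    apply: powsum_bound => // l lk.
    by rewrite tuple_fun_size; apply: le_trans (fM _) (ler_norm _).
rewrite ge0_integralZl//; last 2 first.
- exact: measurable_mass_exp.
- by move=> eta _; exact: expe_ge0.
apply: lte_mul_pinfty; rewrite ?lee_fin//.
(* The moment hypothesis starts at exponent 1; for k = 0 the integral is the total mass of rho. *)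
have [->|k0] := posnP k; last by apply: hmom; rewrite muln_gt0 k0.
by under eq_integral do rewrite expe0; rewrite integral_cst// mul1e -ge0_fin_numE// fin_num_measure.
Qed.

Lemma L2_polys n : @polys R d E n `<=` L2 rho.
Proof.
move=> _ [m [c [k [f [fP ->]]]]]; elim: m c k f fP => [|m IH] c k f fP.
  under eq_fun do rewrite big_ord0.
  apply/L2P; split => //; apply/sqr_integrableP => //.
  by under eq_integral do rewrite expr0n; rewrite integral0.
under eq_fun do rewrite big_ord_recl.
apply: L2D.
  by apply: L2Z; apply: L2_tensor; case: (fP ord0).
by apply: (IH (fun i => c (lift ord0 i)) (fun i => k (lift ord0 i))) => i.
Qed.

Lemma semigroupE F : measurable_fun setT F -> Pt F = kernel_op (transition hX t0) F.
Proof.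
move=> mF; apply/funext => eta; rewrite /semigroup /kernel_op /Rintegral; congr fine.
have mEF : measurable_fun setT (EFin \o F) by exact/measurable_EFinP.
rewrite [RHS]integralE !ge0_integral_transition//;
  [|exact: measurable_funeneg|exact: measurable_funepos].
rewrite integralE; congr (_ - _)%E; apply: eq_integral => w _.
  by rewrite !funeposE.
by rewrite !funenegE.
Qed.

Let transition1 eta : (transition hX t0 eta setT = 1)%E.
Proof. by rewrite /transition /= /pushforward preimage_setT probability_setT. Qed.

Let transition_rev f g : bounded_measurable f -> bounded_measurable g ->
  L2_inner rho f (kernel_op (transition hX t0) g) =
  L2_inner rho g (kernel_op (transition hX t0) f).
Proof.
move=> bf bg; rewrite -!semigroupE; [|by case: bf|by case: bg].
exact: hrev.
Qed.

Lemma L2_semigroup f : L2 rho f -> L2 rho (Pt f).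
Proof.
move=> Lf; rewrite semigroupE; last exact: L2_measurable Lf.
exact: (L2_kernel_op (measurable_transition hX t0) transition1 transition_rev).
Qed.

Lemma L2_semigroup_sym f g : L2 rho f -> L2 rho g ->
  L2_inner rho (Pt f) g = L2_inner rho f (Pt g).
Proof.
move=> Lf Lg; rewrite L2_innerC !semigroupE; [|exact: L2_measurable Lg|exact: L2_measurable Lf].
exact: (kernel_op_sym (measurable_transition hX t0) transition1 transition_rev).
Qed.

Lemma orth_poly_intertwining n (f : n.-tuple E -> R) : (0 < n)%N ->
  symmetric_bounded f ->
  {ae rho, forall eta, Pt (orth_poly rho f) eta =
    orth_poly rho (npart_semigroup X P t f) eta}.
Proof.
move=> n0 sf; have [bf _] := sf.
have bp := bounded_measurable_npart hE hX hconserv t0 sf.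
set pf := npart_semigroup X P t f in bp *.
pose S := @polys R d E n.-1.
have SL : S `<=` L2 rho by exact: L2_polys.
have S0 : S (cst 0) by exact: polys0.
have SDZ a F G : S F -> S G -> S (fun x => F x + a * G x) by exact: polys_linear.
pose K := L2_orth rho (L2_closure rho S).
have KE : K = L2_orth rho S by exact: L2_orth_closure.
have KPt k : K k -> K (Pt k).
  rewrite KE => -[Lk ok]; split; first exact: L2_semigroup.
  move=> g Sg; rewrite L2_semigroup_sym//; last exact: SL.
  by apply: ok; exact: semigroup_polys.
have LF := L2_tensor bf; have LG := L2_tensor bp.
have [Kh [LFh oh]] := L2_proj_orthP SL S0 SDZ LF.
apply: (L2_proj_orth_unique (S := S) (F := fun eta => tensor eta pf)); last first.
  exact: L2_proj_orthP.
rewrite -/K in Kh oh *; rewrite -/(orth_poly rho f) in Kh LFh oh *.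
set h := orth_poly rho f in Kh LFh oh *.
have Lh : L2 rho h by case: Kh.
have LPh := L2_semigroup Lh; have LPF := L2_semigroup LF.
split; first exact: KPt.
split; first exact: L2B.
move=> k Kk; have Lk : L2 rho k by case: Kk.
have LPk := L2_semigroup Lk.
(* The residual is P_t applied to the residual of h, minus the difference of P_t of the tensor power
   of f and the tensor power of [pf]. The former is orthogonal to k because P_t is symmetric and
   preserves K, the latter because it is a polynomial of degree at most n - 1. *)
have -> : L2_inner rho ((fun eta => tensor eta pf) \- Pt h) k =
    (L2_inner rho (Pt (fun eta => tensor eta f)) k - L2_inner rho (Pt h) k) -
    (L2_inner rho (Pt (fun eta => tensor eta f)) k -
     L2_inner rho (fun eta => tensor eta pf) k).
  by rewrite L2_innerBl//; ring.
rewrite !L2_semigroup_sym// -L2_innerBl// (oh _ (KPt _ Kk)) sub0r.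
rewrite -L2_semigroup_sym// -L2_innerBl// L2_innerC.
have [_ ->] : L2_orth rho S k by rewrite -KE.
  by rewrite oppr0.
exact: semigroup_tensor.
Qed.

End orthogonal_polynomials_intertwining.

Theorem theorem3p15 (R : realType)
  (d : measure_display) (E : measurableType d)
  (d' : measure_display) (Om : measurableType d')
  (X : R -> Om -> Nfin R E) (P : Nfin R E -> probability Om R)
  (rho : probability (Nfin R E) R)
  (hE : borel_space R E)
  (hX : is_markov_process X P)
  (hcons : consistent X P)
  (hconserv : conservative X P)
  (hrev : reversible X P rho)
  (hmom : forall n : nat, (0 < n)%N ->
     (\int[rho]_eta (eta setT ^+ n) < +oo)%E) :
  forall t : R, 0 <= t ->
  forall n : nat, (0 < n)%N ->
  forall fn : n.-tuple E -> R, symmetric_bounded fn ->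
  {ae rho, forall eta,
     semigroup X P t (orth_poly rho fn) eta =
     orth_poly rho (npart_semigroup X P t fn) eta}.
Proof.
move=> t t0 n n0 fn sf.
exact: (orth_poly_intertwining hE hX hcons hconserv hrev hmom t0 n0 sf).
Qed.
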